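(* Let $1\le p<\infty$, let $T:X\to Y$ be a continuous linear operator between Banach spaces and let $\Phi:\widehat X\to C(B_{X^*})$ be a bounded homogeneous map. The following assertions are equivalent. (1) There are a constant $K>0$ and a Banach function space $Z$ over a finite Borel measure $\mu$ on $B_{X^*}$ such that the identification map $C(B_{X^*})\to Z$ is well-defined (and so continuous), and for each finite set $x_1,\dots,x_n\in X$, $$\Big(\sum_{i=1}^n\|T(x_i)\|^p\Big)^{1/p}\le K\Big\|\Big(\sum_{i=1}^n|\Phi(\langle x_i,\cdot\rangle)|^p\Big)^{1/p}\Big\|_{Z}.$$ (2) $T$ is $\Phi$-abstract $p$-summing, that is, there is a constant $K>0$ such that for each finite set $x_1,\dots,x_n\in X$, $$\Big(\sum_{i=1}^n\|T(x_i)\|^p\Big)^{1/p}\le K\Big\|\Big(\sum_{i=1}^n|\Phi(\langle x_i,\cdot\rangle)|^p\Big)^{1/p}\Big\|_{C(B_{X^*})}.$$ (3) There are a constant $K>0$ and a Borel probability measure $\eta$ on $B_{X^*}$ such that $$\|T(x)\|\le K\Big(\int_{B_{X^*}}|\Phi(\langle x,\cdot\rangle)|^p\,d\eta\Big)^{1/p}\quad\text{for all }x\in X.$$ (4) There are a Borel probability measure $\eta$ on $B_{X^*}$, with associated domination space $(\widehat X)_\Phi^{L^p}$ defined by $\Phi$ and $L^p(\eta)$, and a continuous linear operator $\widehat T:(\widehat X)_\Phi^{L^p}\to Y$ such that $T=\widehat T\circ i_{(\widehat X)_\Phi^{L^p}}\circ i$.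
   Context: Banach spaces are over $\mathbb K=\mathbb R$ or $\mathbb C$. $B_{X^*}$ is the closed unit ball of the dual $X^*$, a compact Hausdorff space with the weak* topology; $C(B_{X^*})$ is the space of scalar continuous functions on it with the supremum norm. For $x\in X$, $\langle x,\cdot\rangle\in C(B_{X^*})$ is the function $x^*\mapsto\langle x,x^*\rangle$; $i:X\to\widehat X:=\{\langle x,\cdot\rangle:x\in X\}\subset C(B_{X^*})$, $i(x)=\langle x,\cdot\rangle$, is an isometric linear embedding. A (not necessarily linear) map $\Phi$ between normed spaces is homogeneous if $\Phi(\lambda v)=\lambda\Phi(v)$ for all real $\lambda>0$ and all $v$; it is bounded if there is a constant $K$ with $\|\Phi(v)\|\le K\|v\|$ for all $v$. Banach function space over a (complete) finite measure $\mu$: a Banach space $Z=Z(\mu)$ of equivalence classes (modulo $\mu$-a.e. equality) of measurable scalar functions with $Z\subset L^1(\mu)$, containing all simple functions, and such that if $g\in Z$, $f$ is measurable and $|f|\le|g|$ $\mu$-a.e., then $f\in Z$ and $\|f\|_Z\le\|g\|_Z$. The identification map $C(B_{X^*})\to Z$ is well-defined if the map sending each $f$ to its $\mu$-a.e. equivalence class $[f]$ is a well-defined continuous map into $Z$. Domination space: for a Borel probability measure $\eta$ on $B_{X^*}$, put $$\|\langle x,\cdot\rangle\|_{\Phi,L^p}:=\inf\Big\{\sum_{i=1}^r\Big(\int_{B_{X^*}}|\Phi(\langle x_i,\cdot\rangle)|^p\,d\eta\Big)^{1/p}:\ r\in\mathbb N,\ x_i\in X,\ x=\sum_{i=1}^r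 x_i\Big\}.$$ It is a standing assumption that, for every $\eta$, this functional is a seminorm on $\widehat X$ that is continuous for the norm of $\widehat X$. Let $N:=\{\langle x,\cdot\rangle\in\widehat X:\|\langle x,\cdot\rangle\|_{\Phi,L^p}=0\}$. The domination space $(\widehat X)_\Phi^{L^p}$ is the completion of $\widehat X/N$ with the induced norm, and $i_{(\widehat X)_\Phi^{L^p}}:\widehat X\to(\widehat X)_\Phi^{L^p}$ is the quotient map $\langle x,\cdot\rangle\mapsto[\langle x,\cdot\rangle]$. *)

(* Defs.v *)
From HB Require Import structures.
From mathcomp Require Import all_boot all_order all_algebra.
From mathcomp Require Import all_classical all_reals all_analysis.
From mathcomp Require Import complex.

Set Implicit Arguments.
Unset Strict Implicit.
Unset Printing Implicit Defensive.

Import Order.TTheory GRing.Theory Num.Theory.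
Import numFieldNormedType.Exports.

Local Open Scope classical_set_scope.
Local Open Scope ring_scope.

Variant scalar_kind := RealScalars | ComplexScalars.

Definition scalar_field (R : realType) (s : scalar_kind) : numFieldType :=
  match s with
  | RealScalars => R
  | ComplexScalars => R[i]
  end.

Definition real_part (R : realType) (s : scalar_kind) :
    scalar_field R s -> R :=
  match s return scalar_field R s -> R with
  | RealScalars => id
  | ComplexScalars => @complex.Re R
  end.

Definition of_real (R : realType) (s : scalar_kind) :
    R -> scalar_field R s :=
  match s return R -> scalar_field R s with
  | RealScalars => id
  | ComplexScalars => fun x => x%:C%C
  end.
Arguments of_real {R s} x.

(* The library's norms take their values in the scalar field (in R[i] in the
   complex case); [nrm] reads the norm as a real number. *)
Definition nrm (R : realType) (s : scalar_kind)
  (V : normedZmodType (scalar_field R s)) (v : V) : R := real_part `|v|.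

Section DualBall.
Context {R : realType} {s : scalar_kind}.
Local Notation K := (scalar_field R s).

(* The third clause is the bound by 1 of the operator norm. *)
Definition dual_ball_set (X : normedModType K) : set {ptws X -> K} :=
  [set f | [/\ scalar (f : X -> K), continuous (f : X -> K) &
               forall x : X, nrm x <= 1 -> nrm (f x) <= 1]].

(* [set_type] carries the topology induced from the pointwise convergence of
   {ptws X -> K}, which on the dual ball is the weak* topology. *)
Definition dual_ball (X : normedModType K) : Type :=
  set_type (@dual_ball_set X).

Section Instances.
Variable X : normedModType K.

Fact dual_ball0 : (fun=> 0 : K) \in @dual_ball_set X.
Proof.
rewrite inE; split; first by move=> a u v; rewrite mulr0 addr0.
  by move=> x; exact: cvg_cst.
by rewrite /nrm => x _; rewrite normr0; case: (s) => /=; exact: ler01.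
Qed.

HB.instance Definition _ := Topological.on (dual_ball X).
HB.instance Definition _ :=
  isPointed.Build (dual_ball X) (SigSub dual_ball0).

End Instances.

Definition dual_ball_fun (X : normedModType K) (b : dual_ball X) : X -> K :=
  \val b.
Coercion dual_ball_fun : dual_ball >-> Funclass.

Definition borel_ball (X : normedModType K) :=
  g_sigma_algebraType (@open (dual_ball X)).

End DualBall.

Section ContinuousFunctions.
Context {R : realType} {s : scalar_kind}.
Local Notation K := (scalar_field R s).
Variable X : normedModType K.

(* The dual ball is nonempty and weak*-compact (Banach-Alaoglu), so on
   continuous functions this [sup] in R is a genuine least upper bound. *)
Definition sup_norm (f : dual_ball X -> K) : R :=
  sup [set nrm (f b) | b in [set: dual_ball X]].

Definition continuous_pred : {pred dual_ball X -> K^o} :=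
  mem [set f : dual_ball X -> K^o | continuous f].

Fact continuous_submod_closed : submod_closed continuous_pred.
Proof.
split=> [|a f g]; rewrite !inE /=.
  exact: (@cst_continuous (dual_ball X) K^o 0).
move=> cf cg b; apply: (@cvgD K K^o _ (nbhs b) _ (fun x => a *: f x) g).
  by apply: (@cvgZl_tmp K K^o); exact: cf.
exact: cg.
Qed.

HB.instance Definition _ := GRing.isSubmodClosed.Build K (dual_ball X -> K^o)
  continuous_pred continuous_submod_closed.

(* C(B_{X^*}) as a vector space; its norm is [sup_norm]. *)
Record cont_ball := ContBall {
  cont_fun :> dual_ball X -> K^o;
  cont_funP : cont_fun \in continuous_pred }.

HB.instance Definition _ := [isSub for cont_fun].
HB.instance Definition _ := [Choice of cont_ball by <:].
HB.instance Definition _ := [SubChoice_isSubLmodule of cont_ball by <:].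

Fact pairing_continuous (x : X) :
  (fun b : dual_ball X => b x : K^o) \in continuous_pred.
Proof.
rewrite inE /= => b.
apply: (@continuous_comp _ {ptws X -> K} K
  (set_val : dual_ball X -> {ptws X -> K}) (fun f => f x)).
  exact: initial_continuous.
exact: (@proj_continuous X (fun=> K) x).
Qed.

(* The function <x,.>. *)
Definition pairing (x : X) : cont_ball := ContBall (pairing_continuous x).

Fact pairing_linear : linear pairing.
Proof.
move=> a x y; apply/val_inj/funext => b /=.
by have /set_mem [lin_b _ _] := valP b; exact: lin_b.
Qed.

HB.instance Definition _ :=
  GRing.isLinear.Build K X cont_ball *:%R pairing pairing_linear.

Definition hat_pred : {pred cont_ball} := mem (range pairing).

Fact hat_submod_closed : submod_closed hat_pred.
Proof.
split=> [|a _ _ /set_mem[x _ <-] /set_mem[y _ <-]]; apply/mem_set.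
  by exists 0; rewrite ?linear0.
by exists (a *: x + y); rewrite ?linearP.
Qed.

HB.instance Definition _ := GRing.isSubmodClosed.Build K cont_ball
  hat_pred hat_submod_closed.

(* The subspace of all <x,.> in C(B_{X^*}), normed by [sup_norm]. *)
Record hat := Hat { hat_val :> cont_ball; hat_valP : hat_val \in hat_pred }.

HB.instance Definition _ := [isSub for hat_val].
HB.instance Definition _ := [Choice of hat by <:].
HB.instance Definition _ := [SubChoice_isSubLmodule of hat by <:].

Fact pairing_in_hat (x : X) : pairing x \in hat_pred.
Proof. by rewrite inE; exists x. Qed.

Definition to_hat (x : X) : hat := Hat (pairing_in_hat x).

End ContinuousFunctions.

Section Maps.
Context {R : realType} {s : scalar_kind}.
Local Notation K := (scalar_field R s).
Context {X : normedModType K}.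

Definition pos_homogeneous (Phi : hat X -> cont_ball X) :=
  forall (l : R) (h : hat X), 0 < l ->
    Phi (of_real l *: h) = of_real l *: Phi h.

Definition bounded_map (Phi : hat X -> cont_ball X) :=
  exists C : R, forall h : hat X, sup_norm (Phi h) <= C * sup_norm h.

(* The continuous function (sum_i |Phi(<x_i,.>)|^p)^(1/p). *)
Definition p_sum (Phi : hat X -> cont_ball X) (p : R) (n : nat)
    (x : 'I_n -> X) : dual_ball X -> K :=
  fun b => of_real
    ((\sum_(i < n) nrm (Phi (to_hat (x i)) b) `^ p) `^ p^-1).

(* The L^p(eta) norm of Phi(<x,.>). *)
Definition p_mean (Phi : hat X -> cont_ball X) (p : R)
    (eta : probability (borel_ball X) R) (x : X) : R :=
  (\int[eta]_b (nrm (Phi (to_hat x) b) `^ p)) `^ p^-1.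

(* Since x |-> <x,.> is linear and injective, h = <x_0 + ... + x_r,.> says that
   the x_i add up to the vector x such that h = <x,.>. *)
Definition dom_norm (Phi : hat X -> cont_ball X) (p : R)
    (eta : probability (borel_ball X) R) (h : hat X) : R :=
  inf [set a | exists (r : nat) (x : 'I_r.+1 -> X),
    h = to_hat (\sum_(i < r.+1) x i) /\
    a = \sum_(i < r.+1) p_mean Phi p eta (x i)].

Definition seminorm (V : lmodType K) (q : V -> R) :=
  (forall u v, q (u + v) <= q u + q v) /\
  (forall (a : K) v, q (a *: v) = nrm a * q v).

Definition sup_norm_continuous (q : hat X -> R) :=
  forall (h : hat X) (e : R), 0 < e -> exists2 d : R, 0 < d &
    forall h' : hat X, sup_norm (h' - h) < d -> `|q h' - q h| < e.

(* The quotient of [hat X] by N = {h | q h = 0} with the norm induced by q,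
   followed by a completion (a Banach space containing the quotient isometrically
   as a dense subspace). Each of the two steps determines its result up to a
   unique linear isometric isomorphism compatible with the maps. *)
Record domination_space (q : hat X -> R) := DominationSpace {
  dom_quotient : normedModType K;
  dom_proj : {linear hat X -> dom_quotient};
  dom_proj_surj : forall w, exists h, dom_proj h = w;
  dom_proj_ker : forall h, dom_proj h = 0 <-> q h = 0;
  dom_proj_norm : forall h, nrm (dom_proj h) = q h;
  dom_completion :> completeNormedModType K;
  dom_embed : {linear dom_quotient -> dom_completion};
  dom_embed_norm : forall w, nrm (dom_embed w) = nrm w;
  dom_embed_dense : closure (range dom_embed) = setT }.

Definition dom_map (q : hat X -> R) (D : domination_space q) (h : hat X) : D :=
  dom_embed D (dom_proj D h).

End Maps.

Section BanachFunctionSpace.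
Context {R : realType} {s : scalar_kind}.
Local Notation K := (scalar_field R s).

Definition borel_scalar := g_sigma_algebraType (@open K).

(* A norm on a space of classes modulo mu-a.e. equality, seen as a function on
   the representatives. *)
Definition ae_class_norm
    d (S : measurableType d) (mu : {measure set S -> \bar R})
    (Z : set (S -> K^o)) (N : (S -> K^o) -> R) :=
  [/\ forall f g, Z f -> Z g -> N (f + g) <= N f + N g,
      forall (a : K) f, Z f -> N (a *: f) = nrm a * N f &
      forall f, Z f -> (N f = 0 <-> {ae mu, forall t, f t = 0})].

(* A space of classes is given as the set [bfs_mem] of all representatives of
   its elements. Taking |f| = |g| a.e. in [bfs_ideal] shows that membership and
   norm do not depend on the representative. *)
Record banach_function_space d (S : measurableType d)
    (mu : {measure set S -> \bar R}) := BanachFunctionSpace {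
  bfs_mem :> set (S -> K^o);
  bfs_norm : (S -> K^o) -> R;
  bfs_measurable : forall f, bfs_mem f ->
    measurable_fun [set: S] (f : S -> borel_scalar);
  bfs_integrable : forall f, bfs_mem f ->
    mu.-integrable [set: S] (fun t => (nrm (f t))%:E);
  bfs_simple : forall f, measurable_fun [set: S] (f : S -> borel_scalar) ->
    finite_set (range f) -> bfs_mem f;
  bfs_linear : forall (a : K) f g, bfs_mem f -> bfs_mem g ->
    bfs_mem (a *: f + g);
  bfs_normP : ae_class_norm mu bfs_mem bfs_norm;
  bfs_complete : forall u : nat -> S -> K^o,
    (forall n, bfs_mem (u n)) ->
    (forall e : R, 0 < e -> exists n0 : nat, forall m n : nat,
       (n0 <= m)%N -> (n0 <= n)%N -> bfs_norm (u m - u n) < e) ->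
    exists2 f, bfs_mem f & bfs_norm (u n - f) @[n --> \oo] --> (0 : R);
  bfs_ideal : forall f g, bfs_mem g ->
    measurable_fun [set: S] (f : S -> borel_scalar) ->
    {ae mu, forall t, nrm (f t) <= nrm (g t)} ->
    bfs_mem f /\ bfs_norm f <= bfs_norm g }.

Context {X : normedModType K}.

(* The completion of a Borel measure: the outer measure of mu on its
   Caratheodory sigma-algebra, which for a finite mu is the sigma-algebra of
   mu-completed Borel sets. *)
Definition completion (mu : {measure set (borel_ball X) -> \bar R}) :
    {measure set (caratheodory_type (mu^*)%mu) -> \bar R} :=
  @completed_measure_extension _ (borel_ball X) R mu.

Definition identification_continuous
    (mu : {measure set (borel_ball X) -> \bar R})
    (Z : banach_function_space (completion mu)) :=
  (forall f : cont_ball X, bfs_mem Z f) /\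
  (forall (f : cont_ball X) (e : R), 0 < e -> exists2 d : R, 0 < d &
     forall g : cont_ball X, sup_norm (g - f) < d ->
       bfs_norm Z (g - f) < e).

End BanachFunctionSpace.

(* Main.v *)
Require Import Defs.
From HB Require Import structures.
From mathcomp Require Import all_boot all_order all_algebra.
From mathcomp Require Import all_classical all_reals all_analysis.
From mathcomp Require Import measurable_realfun complex generic_quotient ring lra.
Import Order.TTheory GRing.Theory Num.Theory.
Import numFieldNormedType.Exports.

Set Implicit Arguments.
Unset Strict Implicit.
Unset Printing Implicit Defensive.

Local Open Scope classical_set_scope.
Local Open Scope ring_scope.

(** The assertions are proved in a cycle.

    From a Banach function space to the supremum norm: the identification of
    continuous functions with their classes is linear and continuous, hence
    bounded, so the norm in Z of (sum_i |Phi(x_i)|^p)^(1/p) is at most a constant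
    times its supremum ([identification_bounded]).

    From the summing inequality to a dominating measure: this is Pietsch's
    argument ([pietsch_domination]). The functions
    K^p sum_i |Phi(x_i)|^p - sum_i |T x_i|^p form a convex cone in the bounded
    functions on the dual ball, and the inequality says that none of them is
    below a negative constant. The Hahn--Banach theorem then yields a positive
    normalized functional L on bounded functions that is nonnegative on the cone
    ([cone_positive_functional]), so |T x|^p <= K^p L(|Phi(x)|^p). Instead of
    representing L on continuous functions, the proof evaluates it on indicators.
    This gives a finitely additive probability m on all subsets of the compact
    Hausdorff dual ball, and m is turned into a Borel probability eta by inner
    approximation of open sets by closed ones, outer approximation by open sets,
    and Caratheodory's criterion ([borel_probability_above_fap]). On closed sets
    eta is at least m. The superlevel sets of |Phi(x)|^p are closed, so a
    layer-cake sum shows that its integral is at least L(|Phi(x)|^p)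
    ([functional_le_integral]).

    From the measure to the factorization: the bound of |T x| by the p-mean of x
    adds up along decompositions of x, so |T x| is at most K times the domination
    seminorm of <x,.> ([nrm_le_dom_norm]). A linear map into a Banach space that
    is dominated by a linear map with dense range factors through it
    ([dense_factorization]); the latter is here the canonical map into the
    completed quotient.

    From the factorization back to a Banach function space: the domination
    seminorm is at most the p-mean, so |T x| <= c (int |Phi(x)|^p d eta)^(1/p).
    Adding p-th powers bounds (sum_i |T x_i|^p)^(1/p) by c times the norm of
    (sum_i |Phi(x_i)|^p)^(1/p) in L^p(eta), hence in L^infinity(eta), which is the
    Banach function space used ([summing_essentially_bounded]).

    Real and complex scalars are handled together: norms are read as real
    numbers, and the few topological facts about the scalar field are drawn from
    one Lipschitz parametrization by the real plane ([scalar_coords]). *)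

(** * Real-valued norms and the two scalar fields *)

Lemma invS_small (R : realType) (e : R) : 0 < e ->
  exists N : nat, forall n, (N <= n)%N -> n.+1%:R^-1 < e.
Proof.
move=> e0; exists (Num.bound e^-1) => n Nn.
rewrite invf_plt ?posrE//; apply: (@lt_trans _ _ n%:R); last by rewrite ltr_nat.
apply: lt_le_trans (archi_boundP _) _; first by rewrite invr_ge0 ltW.
by rewrite ler_nat.
Qed.

Section RealValuedNorm.
Context {R : realType} {s : scalar_kind}.
Local Notation K := (scalar_field R s).

Lemma of_real0 : of_real (0 : R) = 0 :> K.
Proof. by case: (s). Qed.

Lemma of_real1 : of_real (1 : R) = 1 :> K.
Proof. by case: (s). Qed.

Lemma of_realD (x y : R) : of_real (x + y) = of_real x + of_real y :> K.
Proof. by case: (s) => //=; rewrite rmorphD. Qed.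

Lemma of_realM (x y : R) : of_real (x * y) = of_real x * of_real y :> K.
Proof. by case: (s) => //=; rewrite rmorphM. Qed.

Lemma of_realK (x : R) : real_part (of_real x : K) = x.
Proof. by case: (s). Qed.

Lemma le_of_real (x y : R) : (of_real x <= of_real y :> K) = (x <= y).
Proof. by case: (s) => //=; exact: lecR. Qed.

Lemma lt_of_real (x y : R) : (of_real x < of_real y :> K) = (x < y).
Proof. by case: (s) => //=; exact: ltcR. Qed.

Lemma ge0_real_partK (e : K) : 0 <= e -> of_real (real_part e) = e.
Proof.
case: (s) e => //= e e0; apply: RRe_real; exact: ger0_real.
Qed.

Lemma gt0_real_part (e : K) : 0 < e -> 0 < real_part e.
Proof. by move=> e0; rewrite -lt_of_real of_real0 ge0_real_partK// ltW. Qed.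

Section NormedZmodule.
Variable V : normedZmodType K.
Implicit Types v w : V.

Lemma norm_of_real v : `|v| = of_real (nrm v).
Proof. by rewrite ge0_real_partK. Qed.

Lemma nrm_ge0 v : 0 <= nrm v.
Proof. by rewrite -le_of_real -norm_of_real of_real0. Qed.

Lemma nrm0 : nrm (0 : V) = 0.
Proof. by rewrite /nrm normr0 -of_real0 of_realK. Qed.

Lemma nrmN v : nrm (- v) = nrm v.
Proof. by rewrite /nrm normrN. Qed.

Lemma nrmBC v w : nrm (v - w) = nrm (w - v).
Proof. by rewrite -nrmN opprB. Qed.

Lemma ler_nrmD v w : nrm (v + w) <= nrm v + nrm w.
Proof. by rewrite -le_of_real of_realD -!norm_of_real ler_normD. Qed.

Lemma ler_nrmB v w : nrm v - nrm w <= nrm (v - w).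
Proof. by rewrite lerBlDr -{1}(subrK w v) ler_nrmD. Qed.

Lemma ler_dist_nrm v w : `|nrm v - nrm w| <= nrm (v - w).
Proof. by rewrite ler_norml lerNl opprB {1}nrmBC !ler_nrmB. Qed.

Lemma nrm_eq0 v : nrm v = 0 -> v = 0.
Proof. by move=> v0; apply/eqP; rewrite -normr_eq0 norm_of_real v0 of_real0. Qed.

Lemma ler_nrm_sum n (f : 'I_n -> V) : nrm (\sum_(i < n) f i) <= \sum_(i < n) nrm (f i).
Proof.
elim/big_ind2 : _ => [|x1 x2 y1 y2 h1 h2|//]; first by rewrite nrm0.
by apply: (le_trans (ler_nrmD _ _)); exact: lerD.
Qed.

End NormedZmodule.

Lemma nrmZ (V : normedModType K) (a : K) (v : V) : nrm (a *: v) = nrm a * nrm v.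
Proof.
by rewrite -[LHS](@of_realK) -norm_of_real normrZ !norm_of_real -of_realM of_realK.
Qed.

Lemma nrmM (a b : K) : nrm (a * b) = nrm a * nrm b.
Proof.
by rewrite -[LHS](@of_realK) -norm_of_real normrM !norm_of_real -of_realM of_realK.
Qed.

Lemma nrm_of_real (x : R) : nrm (of_real x : K) = `|x|.
Proof.
have nonneg (y : R) : 0 <= y -> nrm (of_real y : K) = y.
  by move=> y0; rewrite /nrm ger0_norm ?of_realK// -of_real0 le_of_real.
have [x0|x0] := leP 0 x; first by rewrite nonneg// ger0_norm.
rewrite ltr0_norm// -[RHS]nonneg ?oppr_ge0 1?ltW// -[in RHS]mulN1r of_realM nrmM.
have -> : nrm (of_real (-1) : K) = 1; last by rewrite mul1r.
suff -> : of_real (-1) = -1 :> K by rewrite nrmN -[1]of_real1 nonneg.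
by apply/eqP; rewrite -addr_eq0 -of_real1 -of_realD addNr of_real0.
Qed.

Lemma nrmV (a : K) : nrm a^-1 = (nrm a)^-1.
Proof.
have [->|a0] := eqVneq a 0; first by rewrite invr0 nrm0 invr0.
have na0 : nrm a != 0 by apply: contra_neq a0; exact: nrm_eq0.
apply: (mulfI na0); rewrite divff// -nrmM divff// -[1]of_real1 nrm_of_real.
exact: normr1.
Qed.

Lemma ball_nrm (V : normedModType K) (x y : V) (e : R) :
  ball x (of_real e) y = (nrm (x - y) < e) :> Prop.
Proof. by rewrite -ball_normE /ball_ /= norm_of_real lt_of_real. Qed.

Lemma nbhs_nrm (V : normedModType K) (x : V) (A : set V) :
  nbhs x A <-> exists2 e : R, 0 < e & forall y, nrm (x - y) < e -> A y.
Proof.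
split=> [/nbhs_ballP[e /= e0 eA]|[e e0 eA]].
  exists (real_part e); first exact: gt0_real_part.
  by move=> y; rewrite -ball_nrm ge0_real_partK ?ltW//; exact: eA.
apply/nbhs_ballP; exists (of_real e) => /=.
  by rewrite /= -[ltLHS]of_real0 lt_of_real.
by move=> y; rewrite ball_nrm; exact: eA.
Qed.

Lemma nrm_continuous (V : normedModType K) : continuous (@nrm R s V).
Proof.
move=> v; apply/cvgrPdist_lt => e e0.
apply/nbhs_nrm; exists e => // w vw.
exact: le_lt_trans (ler_dist_nrm _ _) _.
Qed.

(** Both scalar fields are Lipschitz images of the real plane, with bounded
    preimages of bounded sets; compactness of balls, separability and
    completeness are all read off this parametrization, which avoids treating
    the two fields apart. *)
Lemma scalar_coords : exists c : R * R -> K,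
  (forall a b, nrm (c a - c b) <= `|a.1 - b.1| + `|a.2 - b.2|) /\
  (forall z, exists a, [/\ c a = z, `|a.1| <= nrm z & `|a.2| <= nrm z]).
Proof.
case: (s).
  exists fst; split=> [a b|z]; first by rewrite lerDl.
  by exists (z, 0); rewrite /= normr0; split.
have sqrt_le (x y : R) : Num.sqrt (x ^+ 2 + y ^+ 2) <= `|x| + `|y|.
  rewrite -[leRHS]ger0_norm ?addr_ge0// -sqrtr_sqr ler_wsqrtr// sqrrD.
  by rewrite !real_normK ?num_real// addrAC lerDl mulrn_wge0// mulr_ge0.
exists (fun a => a.1 +i* a.2)%C; split=> [[a1 a2] [b1 b2]|[z1 z2]].
  exact: sqrt_le.
exists (z1, z2); split => //=.
  by rewrite -sqrtr_sqr ler_wsqrtr// lerDl sqr_ge0.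
by rewrite -sqrtr_sqr ler_wsqrtr// lerDr sqr_ge0.
Qed.

Lemma closed_ball_compact (r : R) : compact [set z : K^o | nrm z <= r].
Proof.
have [c [c_lip c_onto]] := scalar_coords.
have c_cont : continuous (c : R * R -> K^o).
  move=> a U /nbhs_nrm[e e0 eU].
  exists (ball a.1 (e / 2), ball a.2 (e / 2)) => /=.
    by split; apply: nbhsx_ballx; rewrite divr_gt0.
  move=> b [/= b1 b2]; apply: eU; apply: le_lt_trans (c_lip _ _) _.
  by rewrite [e]splitr ltrD.
apply: (@subclosed_compact _ _ (c @` (`[- r, r] `*` `[- r, r]))).
- have := @preimage_closed K^o R (@nrm R s K^o) [set x | x <= r].
  apply; last exact: closed_le.
  by move=> z _; exact: nrm_continuous.
- apply: continuous_compact; first exact: continuous_subspaceT.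
  by apply: compact_setX; exact: segment_compact.
move=> z /= zr; have [a [cz a1 a2]] := c_onto z; exists a => //=.
rewrite !in_itv /= -!ler_norml.
by split; [exact: le_trans a1 zr|exact: le_trans a2 zr].
Qed.

Lemma scalar_dense : exists q : rat * rat -> K,
  forall (z : K) (e : R), 0 < e -> exists i, nrm (z - q i) < e.
Proof.
have [c [c_lip c_onto]] := scalar_coords.
exists (fun i => c (ratr i.1, ratr i.2)) => z e e0.
have [a [<- _ _]] := c_onto z.
have near_rat (x : R) : exists q : rat, `|x - ratr q| < e / 2.
  have [|q] := @rat_in_itvoo R (x - e / 2) (x + e / 2); first by lra.
  by rewrite in_itv /= => /andP[q1 q2]; exists q; rewrite ltr_norml; lra.
have [i1 h1] := near_rat a.1; have [i2 h2] := near_rat a.2.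
exists (i1, i2); apply: le_lt_trans (c_lip _ _) _ => /=; lra.
Qed.

Lemma scalar_complete (u : nat -> K) :
  (forall e : R, 0 < e -> exists n0 : nat, forall m n : nat,
     (n0 <= m)%N -> (n0 <= n)%N -> nrm (u m - u n) < e) ->
  exists l : K, forall e : R, 0 < e -> exists n0 : nat, forall n : nat,
     (n0 <= n)%N -> nrm (u n - l) < e.
Proof.
move=> u_cauchy; have [N uN] := u_cauchy 1 ltr01.
have : (u @ \oo) [set z : K^o | nrm z <= nrm (u N) + 1].
  exists N => //= n Nn /=; rewrite -lerBlDl.
  by rewrite (le_trans (ler_nrmB _ _))// ltW// uN.
move=> /(closed_ball_compact _)[l [_ l_cluster]]; exists l => e e0.
have [n0 un0] := u_cauchy (e / 2) ltac:(lra); exists n0 => n n0n.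
have [] := l_cluster [set z | exists2 m, (n0 <= m)%N & z = u m] 
    [set z | nrm (l - z) < e / 2].
- by exists n0 => //= m n0m; exists m.
- by apply/nbhs_nrm; exists (e / 2) => //; lra.
move=> _ [[m n0m ->] /= lm]; have := un0 n m n0n n0m.
have -> : u n - l = (u n - u m) + (u m - l) by rewrite addrA subrK.
by move=> unm; apply: le_lt_trans (ler_nrmD _ _) _; rewrite (nrmBC _ l); lra.
Qed.

End RealValuedNorm.
(** * The dual ball *)

Section DualBallTopology.
Context {R : realType} {s : scalar_kind}.
Local Notation K := (scalar_field R s).
Variable X : normedModType K.

Lemma dual_ball_linear (b : dual_ball X) (a : K) (x y : X) :
  b (a *: x + y) = a * b x + b y.
Proof. by have /set_mem [lin_b _ _] := valP b; exact: lin_b. Qed.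

Lemma dual_ball0E (b : dual_ball X) : b 0 = 0.
Proof.
have := dual_ball_linear b 1 0 0; rewrite scale1r mul1r addr0 => /eqP.
by rewrite -subr_eq0 opprD addNKr oppr_eq0 => /eqP.
Qed.

Lemma dual_ball_le (b : dual_ball X) (x : X) : nrm (b x) <= nrm x.
Proof.
have [x0|x0] := eqVneq (nrm x) 0; first by rewrite (nrm_eq0 x0) dual_ball0E !nrm0.
have nx0 : 0 < nrm x by rewrite lt_neqAle eq_sym x0 nrm_ge0.
have /set_mem [_ _ /(_ (of_real (nrm x)^-1 *: x))] := valP b.
rewrite nrmZ nrm_of_real ger0_norm ?invr_ge0 ?nrm_ge0// mulVf// => /(_ (lexx _)).
have := dual_ball_linear b (of_real (nrm x)^-1) x 0.
rewrite dual_ball0E !addr0 /dual_ball_fun => ->.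
by rewrite nrmM nrm_of_real ger0_norm ?invr_ge0 ?nrm_ge0// ler_pdivrMl// mulr1.
Qed.

(** Continuity is automatic for a linear form of norm at most 1, so the ball is
    cut out by conditions that survive pointwise limits. *)
Lemma dual_ball_setE : @dual_ball_set R s X =
  [set f | (forall a x y, f (a *: x + y) = a * f x + f y) /\
           (forall x, nrm (f x) <= nrm x)].
Proof.
apply/seteqP; split=> f /=.
  move=> /mem_set fP; pose b : dual_ball X := SigSub fP.
  by split=> [a x y|x]; [exact: (dual_ball_linear b)|exact: (dual_ball_le b)].
move=> [f_lin f_le]; split=> //; last by move=> x; exact: le_trans.
move=> x U /nbhs_nrm[e e0 eU]; apply/nbhs_nrm; exists e => // y xy; apply: eU.
apply: le_lt_trans xy; apply: le_trans (f_le _).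
have := f_lin (-1) y x; rewrite scaleN1r addrC mulN1r => ->.
by rewrite addrC.
Qed.

Lemma closure_dual_ball_set (f : {ptws X -> K}) (x y z : X) (e : R) : 0 < e ->
  closure (@dual_ball_set R s X) f ->
  exists g, [/\ @dual_ball_set R s X g, nrm (f x - g x) < e,
    nrm (f y - g y) < e & nrm (f z - g z) < e].
Proof.
move=> e0 f_cl.
have near_f (t : X) : nbhs f [set g : {ptws X -> K} | nrm (f t - g t) < e].
  apply: (@proj_continuous X (fun=> K) t f [set u : K^o | nrm (f t - u) < e]).
  by apply/nbhs_nrm; exists e.
have [g [gB [gx [gy gz]]]] := f_cl _ (filterI (near_f x) (filterI (near_f y) (near_f z))).
by exists g.
Qed.

Lemma dual_ball_set_closed : closed (@dual_ball_set R s X).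
Proof.
move=> f f_cl; rewrite dual_ball_setE /=; split.
  move=> a x y; apply/eqP; rewrite -subr_eq0; apply/eqP.
  apply: (@nrm_eq0 R s K); apply/eqP; rewrite eq_le nrm_ge0 andbT.
  apply/ler_addgt0Pl => e e0; rewrite addr0.
  pose d := e / (2 + nrm a).
  have d0 : 0 < d by rewrite divr_gt0// ltr_wpDr ?nrm_ge0.
  have [g [+ fg1 fg2 fg3]] := closure_dual_ball_set (a *: x + y) x y d0 f_cl.
  rewrite dual_ball_setE /= => -[g_lin _].
  have -> : f (a *: x + y) - (a * f x + f y) =
    (f (a *: x + y) - g (a *: x + y)) + (a * (g x - f x) + (g y - f y)).
    by rewrite g_lin; ring.
  apply: (le_trans (ler_nrmD _ _)); apply: (le_trans (lerD (lexx _) (ler_nrmD _ _))).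
  have -> : e = d + (nrm a * d + d).
    by rewrite /d; field; have := nrm_ge0 a; lra.
  rewrite nrmM lerD ?lerD//; [exact: ltW| |by rewrite nrmBC ltW].
  by rewrite ler_wpM2l ?nrm_ge0// nrmBC ltW.
move=> x; apply/ler_addgt0Pl => e e0.
have [g [+ fg _ _]] := closure_dual_ball_set x x x e0 f_cl.
rewrite dual_ball_setE /= => -[_ /(_ x) g_le].
have := ler_nrmB (f x) (g x); lra.
Qed.

(** The Banach--Alaoglu theorem: the ball is closed in a product of compact
    discs, and cluster points found in the product lift to the subtype because
    its topology is the initial one. *)
Lemma dual_ball_compact : compact [set: dual_ball X].
Proof.
have ball_compact : compact (@dual_ball_set R s X : set {ptws X -> K}).
  apply: (@subclosed_compact {ptws X -> K} _
    [set f : {ptws X -> K} | forall x, nrm (f x) <= nrm x]).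
  - exact: dual_ball_set_closed.
  - apply: (@tychonoff X (fun=> K^o) (fun x => [set z | nrm z <= nrm x])) => x.
    exact: closed_ball_compact.
  - by move=> f; rewrite dual_ball_setE => -[].
move=> F PF _; have := ball_compact (fmap (val : dual_ball X -> {ptws X -> K}) F).
case=> [|f [f_ball f_cl]].
  change (F [set b : dual_ball X | dual_ball_set (val b)]).
  by apply: filterS filterT => b _; exact: set_mem (valP b).
exists (SigSub (mem_set f_ball)); split=> // A B FA [_ [[V oV <-] /= Vf] VB].
have FA' : fmap (val : dual_ball X -> {ptws X -> K}) F [set val b | b in A].
  change (F [set b : dual_ball X | [set val b | b in A] (val b)]).
  by apply: filterS FA => b Ab; exists b.
have [_ [[b Ab <-] Vb]] := f_cl _ _ FA' (open_nbhs_nbhs (conj oV Vf)).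
by exists b; split => //; exact: VB.
Qed.

Lemma dual_ball_hausdorff : hausdorff_space (dual_ball X).
Proof.
have eval_cont (x : X) : continuous (fun b : dual_ball X => b x : K^o).
  by move=> b; have /set_mem := pairing_continuous x; exact.
move=> b c bc; apply/val_inj/funext => x; apply/eqP.
pose ev (a : dual_ball X) : K := a x; change (ev b == ev c).
rewrite -subr_eq0; apply/eqP; apply: (@nrm_eq0 R s K); apply/eqP; rewrite eq_le nrm_ge0 andbT.
apply/ler_addgt0Pl => e e0; rewrite addr0.
have nearby (a : dual_ball X) : nbhs (a : dual_ball X) [set a' | nrm (ev a - ev a') < e / 2].
  apply: (eval_cont x a [set z | nrm (ev a - z) < e / 2]).
  by apply/nbhs_nrm; exists (e / 2) => //; lra.
have [a [/= ba ca]] := bc _ _ (nearby b) (nearby c).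
have -> : ev b - ev c = (ev b - ev a) + (ev a - ev c) by rewrite addrA subrK.
by apply: (le_trans (ler_nrmD _ _)); rewrite (nrmBC (ev a)); lra.
Qed.

End DualBallTopology.
(** * Linear functionals below a sublinear functional *)

Section HahnBanach.
Context {R : realType}.

Definition sublinear (V : lmodType R) (q : V -> R) :=
  (forall u v, q (u + v) <= q u + q v) /\
  (forall (a : R) v, 0 <= a -> q (a *: v) = a * q v).

Section SublinearFunctionals.
Variables (V : lmodType R).
Implicit Types (q : V -> R) (u v : V).

Lemma sublinear_ge q v : sublinear q -> - q (- v) <= q v.
Proof.
move=> [qD qZ]; rewrite -subr_ge0 opprK (le_trans _ (qD _ _))// subrr.
by have := qZ 0 0 (lexx _); rewrite scaler0 mul0r => ->.
Qed.

(** The directional modification q_v(u) = inf over t >= 0 of q(u + t v) - t q(v)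
    stays below q; for a minimal q it equals q, and t = 1 then gives
    q(u) + q(v) <= q(u + v). *)
Lemma minimal_sublinear_additive q : sublinear q ->
  (forall r, sublinear r -> (forall v, r v <= q v) -> r = q) ->
  forall u v, q (u + v) = q u + q v.
Proof.
move=> q_sub q_min u v; have [qD qZ] := q_sub.
pose S w := [set q (w + t *: v) - t * q v | t in [set t | 0 <= t]].
have S_ne w : S w !=set0 by exists (q (w + 0 *: v) - 0 * q v), 0 => /=.
have S_lb w : lbound (S w) (- q (- w)).
  move=> _ [t /= t0 <-].
  by have := qD (- w) (w + t *: v); rewrite addKr qZ//; lra.
have S_inf w : has_inf (S w) by split => //; exists (- q (- w)); exact: S_lb.
pose r w := inf (S w).
have r_le w t : 0 <= t -> r w <= q (w + t *: v) - t * q v.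
  by move=> t0; apply: ge_inf; [exact: (S_inf w).2|exists t].
have r_ge w c : (forall t, 0 <= t -> c <= q (w + t *: v) - t * q v) -> c <= r w.
  by move=> c_le; apply: lb_le_inf => // _ [t /= t0 <-]; exact: c_le.
have rq : r = q.
  apply: q_min; last by move=> w; have := r_le w 0 (lexx _); rewrite scale0r mul0r addr0 subr0.
  split=> [w1 w2|a w].
    apply/ler_addgt0Pl => e e0.
have e2 : 0 < e / 2 by rewrite divr_gt0.
    have [_ [t1 /= t10 <-] h1] := inf_adherent e2 (S_inf w1).
    have [_ [t2 /= t20 <-] h2] := inf_adherent e2 (S_inf w2).
    have := r_le (w1 + w2) (t1 + t2) (addr_ge0 t10 t20).
    rewrite scalerDl addrACA => /le_trans; apply.
    have := qD (w1 + t1 *: v) (w2 + t2 *: v); rewrite /r; lra.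
  rewrite le_eqVlt => /predU1P[<-|a0].
    rewrite scale0r mul0r; apply/eqP; rewrite eq_le; apply/andP; split.
      have := r_le 0 0 (lexx _); rewrite scale0r mul0r subr0 addr0.
      by rewrite -(scale0r (0 : V)) qZ// mul0r.
    by apply: r_ge => t t0; rewrite add0r qZ// subrr.
  apply/eqP; rewrite eq_le; apply/andP; split.
    rewrite -ler_pdivrMl//; apply: r_ge => t t0; rewrite ler_pdivrMl//.
    have := r_le (a *: w) (a * t) (mulr_ge0 (ltW a0) t0).
    rewrite -scalerA -scalerDr qZ ?(ltW a0)//.
    by lra.
  apply: r_ge => t t0; have := r_le w (t / a) (divr_ge0 t0 (ltW a0)).
  have -> : a *: w + t *: v = a *: (w + (t / a) *: v).
    by rewrite scalerDr scalerA mulrCA divff ?gt_eqF// mulr1.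
  rewrite qZ ?(ltW a0)// -(ler_pM2l a0) => /le_trans; apply.
  by rewrite mulrBr mulrA mulrCA divff ?gt_eqF// mulr1.
apply/eqP; rewrite eq_le qD/= -lerBrDr -{1}rq.
by have := r_le u 1 ler01; rewrite scale1r mul1r.
Qed.

(** The Hahn--Banach theorem, in the form that a sublinear functional dominates
    a linear one: Zorn's lemma gives a minimal sublinear functional below q. *)
Lemma sublinear_dominates_linear q : sublinear q ->
  exists L : V -> R, [/\ forall u v, L (u + v) = L u + L v,
    forall a v, L (a *: v) = a * L v & forall v, L v <= q v].
Proof.
move=> q_sub.
pose P := {r : V -> R | sublinear r /\ forall v, r v <= q v}.
pose below (r1 r2 : P) := `[< forall v, sval r2 v <= sval r1 v >].
have q_in : sublinear q /\ forall v, q v <= q v by [].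
have lower (r : P) v : - q (- v) <= sval r v.
  have [r_sub r_le] := svalP r.
  by apply: le_trans (sublinear_ge _ r_sub); rewrite lerN2.
have [||||r r_max] := @Zorn P below.
- by move=> r; apply/asboolP.
- by move=> r1 r2 r3 /asboolP h1 /asboolP h2; apply/asboolP => v; exact: le_trans (h1 v).
- move=> [r1 h1] [r2 h2] /asboolP/= h /asboolP/= h'; apply: eq_exist.
  by apply: funext => v; apply/eqP; rewrite eq_le h h'.
- move=> A A_tot; have [[r0 Ar0]|A0] := pselect (A !=set0); last first.
    exists (exist _ q q_in) => r Ar; exfalso; apply: A0; by exists r.
  pose S v := [set sval r v | r in A].
  have S_inf v : has_inf (S v).
    split; first by exists (sval r0 v), r0.
    by exists (- q (- v)) => _ [r Ar <-]; exact: lower.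
  have inf_le r v : A r -> inf (S v) <= sval r v.
    by move=> Ar; apply: ge_inf; [exact: (S_inf v).2|exists r].
  have inf_in : sublinear (fun v => inf (S v)) /\ forall v, inf (S v) <= q v.
    split; last by move=> v; apply: (le_trans (inf_le _ v Ar0)); exact: (svalP r0).2.
    split=> [u v|a v a0].
      apply/ler_addgt0Pl => e e0.
have e2 : 0 < e / 2 by rewrite divr_gt0.
      have [_ [r1 Ar1 <-] h1] := inf_adherent e2 (S_inf u).
      have [_ [r2 Ar2 <-] h2] := inf_adherent e2 (S_inf v).
      have [r [Ar ru rv]] : exists r, [/\ A r, sval r u <= sval r1 u
          & sval r v <= sval r2 v].
        by have [/asboolP h|/asboolP h] := A_tot _ _ Ar1 Ar2;
          [exists r2|exists r1]; split.
      have := inf_le r (u + v) Ar; have := (svalP r).1.1 u v; lra.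
    have inf_ge w c : (forall r, A r -> c <= sval r w) -> c <= inf (S w).
      by move=> c_le; apply: lb_le_inf (S_inf w).1 _ => _ [r Ar <-]; exact: c_le.
    move: a0; rewrite le_eqVlt => /predU1P[<-|a0].
      rewrite scale0r mul0r; apply/eqP; rewrite eq_le.
      have r_0 (r : P) : sval r 0 = 0.
        by have := (svalP r).1.2 0 0 (lexx _); rewrite scaler0 mul0r.
      rewrite -[leRHS](r_0 r0) inf_le//=; apply: inf_ge => r _.
      by rewrite r_0.
    apply/eqP; rewrite eq_le; apply/andP; split.
      rewrite -ler_pdivrMl//; apply: inf_ge => r Ar; rewrite ler_pdivrMl//.
      by rewrite -(svalP r).1.2 ?(ltW a0)//; exact: inf_le.
    apply: inf_ge => r Ar; rewrite (svalP r).1.2 ?(ltW a0)// ler_pM2l//.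
    exact: inf_le.
  exists (exist _ (fun v => inf (S v)) inf_in) => r Ar; apply/asboolP => v /=; exact: inf_le.
have [r_sub r_le] := svalP r.
have rD : forall u v, sval r (u + v) = sval r u + sval r v.
  apply: minimal_sublinear_additive => // r' r'_sub r'_le.
  have r'_in : sublinear r' /\ forall v, r' v <= q v.
    by split=> // v; exact: le_trans (r_le v).
  have := r_max (exist _ r' r'_in).
  by move=> <-; [|apply/asboolP].
exists (sval r); split=> // a v.
have r0 : sval r 0 = 0 by have := r_sub.2 0 0 (lexx _); rewrite scaler0 mul0r.
have [a0|a0] := leP 0 a; first exact: r_sub.2.
have := rD (a *: v) ((- a) *: v); rewrite -scalerDl subrr scale0r r0.
by rewrite (r_sub.2 (- a)) ?oppr_ge0 ?(ltW a0)// mulNr => /eqP; rewrite eq_sym subr_eq0 => /eqP.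
Qed.

End SublinearFunctionals.
End HahnBanach.
(** * Separation from a cone of bounded functions *)

Section BoundedFunctions.
Context {R : realType} {T : Type}.

Definition bounded_pred : {pred T -> R^o} :=
  mem [set f : T -> R^o | exists c : R, forall t, `|f t| <= c].

Fact bounded_submod_closed : submod_closed bounded_pred.
Proof.
split=> [|a f g]; rewrite !inE /=; first by exists 0 => t; rewrite normr0.
move=> [c fc] [d gd]; exists (`|a| * c + d) => t /=.
apply: (le_trans (ler_normD _ _)); apply: lerD => //.
by rewrite normrM ler_wpM2l.
Qed.

HB.instance Definition _ := GRing.isSubmodClosed.Build R (T -> R^o)
  bounded_pred bounded_submod_closed.

Record bounded_fun := BoundedFun {
  bounded_val :> T -> R^o;
  bounded_valP : bounded_val \in bounded_pred }.

HB.instance Definition _ := [isSub for bounded_val].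
HB.instance Definition _ := [Choice of bounded_fun by <:].
HB.instance Definition _ := [SubChoice_isSubLmodule of bounded_fun by <:].

Lemma bounded_funP (h : bounded_fun) : exists c : R, forall t, `|h t| <= c.
Proof. by have := bounded_valP h; rewrite inE. Qed.

(** The separation argument behind the domination theorem. The functional
    q(h) = inf {c | h + g <= c for some g in the cone} is finite because no g in
    the cone lies below a negative constant; a linear functional below q is
    positive, normalized, and nonnegative on the cone. *)
Lemma cone_positive_functional (P : set bounded_fun) : P 0 ->
  (forall g h, P g -> P h -> P (g + h)) ->
  (forall (a : R) g, 0 < a -> P g -> P (a *: g)) ->
  (forall (g : bounded_fun) (c : R), P g -> (forall t, g t <= c) -> 0 <= c) ->
  exists L : bounded_fun -> R,
    [/\ forall u v, L (u + v) = L u + L v,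
        forall (a : R) v, L (a *: v) = a * L v,
        forall (h : bounded_fun) (c : R), (forall t, h t <= c) -> L h <= c &
        forall g, P g -> 0 <= L g].
Proof.
move=> P0 PD PZ P_sup.
pose S (h : bounded_fun) := [set c : R | exists2 g, P g & forall t, h t + g t <= c].
have S_inf h : has_inf (S h).
  have [B hB] := bounded_funP h; split.
    by exists B; exists 0 => // t; rewrite addr0; exact: le_trans (ler_norm _) _.
  exists (- B) => c [g Pg hg].
  have : 0 <= c + B; last lra.
  apply: (P_sup g) => // t; have := hg t.
  by have := hB t; rewrite ler_norml => /andP[]; lra.
pose q h := inf (S h).
have q_le (h g : bounded_fun) c : P g -> (forall t, h t + g t <= c) -> q h <= c.
  by move=> Pg hg; apply: (ge_inf (S_inf h).2); exists g.
have q_ge (h : bounded_fun) c :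
    (forall (g : bounded_fun) d, P g -> (forall t, h t + g t <= d) -> c <= d) ->
    c <= q h.
  by move=> hc; apply: lb_le_inf (S_inf h).1 _ => d [g Pg hg]; exact: hc hg.
have q_scale_le a h : 0 < a -> q (a *: h) <= a * q h.
  move=> a0; rewrite -ler_pdivrMl//; apply: q_ge => g d Pg hg.
  rewrite ler_pdivrMl//; apply: (q_le _ (a *: g)); first exact: PZ.
  by move=> t; rewrite /= -mulrDr ler_wpM2l// ltW.
have q_sub : sublinear q.
  split=> [u v|a h].
    apply/ler_addgt0Pl => e e0; have e2 : 0 < e / 2 by rewrite divr_gt0.
    have [c [g Pg ug] hc] := inf_adherent e2 (S_inf u).
    have [d [h Ph vh] hd] := inf_adherent e2 (S_inf v).
    have : q (u + v) <= c + d; last by rewrite /q; lra.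
    apply: (q_le _ (g + h)); first exact: PD.
    by move=> t /=; rewrite addrACA lerD.
  rewrite le_eqVlt => /predU1P[<-|a0].
    rewrite scale0r mul0r; apply/eqP; rewrite eq_le (q_le _ 0)//=; last first.
      by move=> t; rewrite addr0.
    apply: q_ge => g d Pg gd; apply: (P_sup g) => // t.
    by have := gd t; rewrite add0r.
  apply/eqP; rewrite eq_le q_scale_le//=.
  have ai : 0 < a^-1 by rewrite invr_gt0.
  have := q_scale_le _ (a *: h) ai.
  by rewrite scalerA mulVf ?gt_eqF// scale1r ler_pdivlMl.
have [L [LD LZ L_le]] := sublinear_dominates_linear q_sub.
exists L; split=> // [h c hc|g Pg].
  by apply: (le_trans (L_le h)); apply: (q_le _ 0) => // t; rewrite addr0.
have := LZ (-1) g; rewrite scaleN1r mulN1r => LN; rewrite -oppr_le0 -LN.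
by apply: (le_trans (L_le _)); apply: (q_le _ g) => // t /=; rewrite addNr.
Qed.

End BoundedFunctions.
Arguments bounded_fun : clear implicits.
(** * Borel regularization of a finitely additive probability *)

Section FinitelyAdditive.
Context {R : realType} {T : Type}.

Definition finitely_additive_probability (m : set T -> R) :=
  [/\ forall A, 0 <= m A, m setT = 1 &
      forall A B, A `&` B = set0 -> m (A `|` B) = m A + m B].

Variable m : set T -> R.
Hypothesis m_fap : finitely_additive_probability m.

Lemma fap_le (A B : set T) : A `<=` B -> m A <= m B.
Proof.
have [m_ge0 _ mU] := m_fap => AB.
have := mU A (B `\` A) (setDIK _ _); rewrite setDUK//.
by have := m_ge0 (B `\` A); lra.
Qed.

Lemma fap_set0 : m set0 = 0.
Proof.
have [_ _ mU] := m_fap.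
by have := mU set0 set0; rewrite setI0 setU0 => /(_ erefl); lra.
Qed.

Lemma fap_le1 (A : set T) : m A <= 1.
Proof. by have [_ <- _] := m_fap; exact: fap_le. Qed.

Lemma fap_subadditive (A B : set T) : m (A `|` B) <= m A + m B.
Proof.
have [_ _ mU] := m_fap; have := mU A (B `\` A) (setDIK _ _).
have -> : A `|` (B `\` A) = A `|` B.
  apply/seteqP; split=> x [Ax|]; [by left|by move=> [Bx _]; right|by left|].
  by move=> Bx; have [Ax|nAx] := pselect (A x); [left|right].
have : B `\` A `<=` B by move=> x [].
by move=> /fap_le; lra.
Qed.

End FinitelyAdditive.

Section Regularization.
Context {R : realType} {T : ptopologicalType}.
Variable m : set T -> R.
Hypothesis T_compact : compact [set: T].
Hypothesis T_hausdorff : hausdorff_space T.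
Hypothesis m_fap : finitely_additive_probability m.

Let m_bounds (U : set T) :
  has_sup [set m C | C in [set C | closed C /\ C `<=` U]].
Proof.
split; first by exists (m set0), set0 => //; split => //; exact: closed0.
by exists 1 => _ [C _ <-]; exact: fap_le1.
Qed.

Definition inner_content (U : set T) : R :=
  sup [set m C | C in [set C | closed C /\ C `<=` U]].

Lemma inner_content_ge (C U : set T) : closed C -> C `<=` U ->
  m C <= inner_content U.
Proof. by move=> cC CU; apply: (ub_le_sup (m_bounds U).2); exists C. Qed.

Lemma inner_content_le (U : set T) (c : R) :
  (forall C, closed C -> C `<=` U -> m C <= c) -> inner_content U <= c.
Proof. by move=> h; apply: ge_sup (m_bounds U).1 _ => _ [C [cC CU] <-]; exact: h. Qed.

Lemma inner_content_adherent (U : set T) (e : R) : 0 < e ->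
  exists C, [/\ closed C, C `<=` U & inner_content U - e < m C].
Proof.
by move=> e0; have [_ [C [cC CU] <-] h] := sup_adherent e0 (m_bounds U); exists C.
Qed.

Lemma inner_content_ge0 (U : set T) : 0 <= inner_content U.
Proof.
by rewrite -(fap_set0 m_fap); apply: inner_content_ge; [exact: closed0|exact: sub0set].
Qed.

(** By normality C minus U and C minus V have disjoint open neighbourhoods;
    removing them from C leaves the two pieces. *)
Lemma closed_setU_split (C U V : set T) : closed C -> open U -> open V ->
  C `<=` U `|` V -> exists C1 C2, [/\ closed C1, closed C2, C1 `<=` U,
    C2 `<=` V & C = C1 `|` C2].
Proof.
move=> cC oU oV CUV.
have := (@normal_openP R T).1 (compact_normal T_hausdorff T_compact).
move=> /(_ (C `\` U) (C `\` V)) [].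
- by rewrite setDE; apply: closedI => //; exact: open_closedC.
- by rewrite setDE; apply: closedI => //; exact: open_closedC.
- by apply/seteqP; split=> // x [[Cx nU] [_ nV]]; case: (CUV _ Cx).
move=> G1 [G2 [oG1 oG2 h1 h2 G12]].
exists (C `\` G1), (C `\` G2); split.
- by rewrite setDE; apply: closedI => //; exact: open_closedC.
- by rewrite setDE; apply: closedI => //; exact: open_closedC.
- by move=> x [Cx nG1]; apply: contrapT => nU; apply: nG1; exact: h1.
- by move=> x [Cx nG2]; apply: contrapT => nV; apply: nG2; exact: h2.
rewrite -setDIr G12 setD0 //.
Qed.

Lemma inner_contentU (U V : set T) : open U -> open V ->
  inner_content (U `|` V) <= inner_content U + inner_content V.
Proof.
move=> oU oV; apply: inner_content_le => C cC CUV.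
have [C1 [C2 [cC1 cC2 CU1 CV2 ->]]] := closed_setU_split cC oU oV CUV.
by apply: le_trans (fap_subadditive m_fap _ _) _; apply: lerD; exact: inner_content_ge.
Qed.

Lemma inner_content_bigcup_le (U : (set T)^nat) (N : nat) : (forall n, open (U n)) ->
  inner_content (\bigcup_(n in `I_N) U n) <= \sum_(0 <= n < N) inner_content (U n).
Proof.
move=> oU; elim: N => [|N IH].
  rewrite II0 bigcup_set0 big_geq//; apply: inner_content_le => C _.
  by rewrite subset0 => ->; rewrite fap_set0.
rewrite IIS bigcup_setU bigcup_set1 big_nat_recr//=.
apply: (le_trans (inner_contentU _ (oU N))); last by rewrite lerD2r.
exact: bigcup_open.
Qed.

(** Countable subadditivity comes for free from compactness: a closed subset of
    a countable union of open sets already lies in a finite union of them. *)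
Lemma inner_content_bigcup (U : (set T)^nat) : (forall n, open (U n)) ->
  ((inner_content (\bigcup_n U n))%:E <= \sum_(n <oo) (inner_content (U n))%:E)%E.
Proof.
move=> oU; have [r Sr] : exists r : \bar R, r = (\sum_(n <oo) (inner_content (U n))%:E)%E.
  by eexists.
have S_ge N : ((\sum_(0 <= n < N) inner_content (U n))%:E <= r)%E.
  rewrite Sr -sumEFin; apply: nneseries_lim_ge => n _ _.
  by rewrite lee_fin inner_content_ge0.
have m_le C : closed C -> C `<=` \bigcup_n U n -> ((m C)%:E <= r)%E.
  move=> cC CU; have C_compact := subclosed_compact cC T_compact (@subsetT _ C).
  have : cover_compact C by rewrite -compact_cover.
  move=> /(_ nat setT U (fun n _ => oU n) CU) [D _ CD].
  pose N := (\max_(i <- finmap.enum_fset D) i).+1; apply: le_trans (S_ge N).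
  rewrite lee_fin; apply: le_trans (inner_content_bigcup_le N oU).
  apply: inner_content_ge => // x Cx; have [i iD Uix] := CD _ Cx.
  exists i => //=; rewrite /N ltnS.
  exact: (@leq_bigmax_seq _ (finmap.enum_fset D) xpredT id i).
rewrite -Sr; case: (r) m_le => [c|_|/(_ set0 closed0 (@sub0set _ _))//].
- move=> m_le; rewrite lee_fin; apply: inner_content_le => C cC CU.
  by rewrite -lee_fin; exact: m_le.
- exact: leey.
Qed.

Definition outer_content (A : set T) : R :=
  inf [set inner_content U | U in [set U | open U /\ A `<=` U]].

Let outer_bounds A :
  has_inf [set inner_content U | U in [set U | open U /\ A `<=` U]].
Proof.
split; first by exists (inner_content setT), setT => //; split => //; exact: openT.
by exists 0 => _ [U _ <-]; exact: inner_content_ge0.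
Qed.

Lemma outer_content_le (A U : set T) : open U -> A `<=` U ->
  outer_content A <= inner_content U.
Proof. by move=> oU AU; apply: (ge_inf (outer_bounds A).2); exists U. Qed.

Lemma outer_content_ge (A : set T) (c : R) :
  (forall U, open U -> A `<=` U -> c <= inner_content U) -> c <= outer_content A.
Proof.
by move=> h; apply: lb_le_inf (outer_bounds A).1 _ => _ [U [oU AU] <-]; exact: h.
Qed.

Lemma outer_content_closed (C : set T) : closed C -> m C <= outer_content C.
Proof. by move=> cC; apply: outer_content_ge => U _; exact: inner_content_ge. Qed.

Lemma outer_contentT : outer_content setT = 1.
Proof.
apply/eqP; rewrite eq_le; apply/andP; split.
  apply: (le_trans (outer_content_le openT (@subsetT _ _))).
  by apply: inner_content_le => C _ _; exact: fap_le1.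
by have [_ <- _] := m_fap; exact: outer_content_closed closedT.
Qed.

Lemma outer_content_adherent (A : set T) (e : R) : 0 < e ->
  exists U, [/\ open U, A `<=` U & inner_content U < outer_content A + e].
Proof.
by move=> e0; have [_ [U [oU AU] <-] h] := inf_adherent e0 (outer_bounds A); exists U.
Qed.

Definition regularization (A : set T) : \bar R := (outer_content A)%:E.

Let regularization0 : regularization set0 = 0%E.
Proof.
congr EFin; apply/eqP; rewrite eq_le; apply/andP; split.
  apply: (le_trans (outer_content_le open0 (@subset_refl _ _))).
  by apply: inner_content_le => C _; rewrite subset0 => ->; rewrite fap_set0.
by apply: outer_content_ge => U _ _; exact: inner_content_ge0.
Qed.

Let regularization_ge0 A : (0 <= regularization A)%E.
Proof. by rewrite lee_fin; apply: outer_content_ge => U _ _; exact: inner_content_ge0. Qed.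

Let regularization_mono : {homo regularization : A B / A `<=` B >-> (A <= B)%E}.
Proof.
move=> A B AB; rewrite lee_fin; apply: outer_content_ge => U oU BU.
by apply: outer_content_le => //; exact: subset_trans BU.
Qed.

Let regularization_subadditive : sigma_subadditive regularization.
Proof.
move=> F; apply/lee_addgt0Pr => e e0.
apply: le_trans (epsilon_trick _ (fun n => regularization_ge0 (F n)) (ltW e0)).
have /choice[U UP] n : exists U, [/\ open U, F n `<=` U &
    inner_content U < outer_content (F n) + e / (2 ^ n.+1)%:R].
  by apply: outer_content_adherent; rewrite divr_gt0// ltr0n expn_gt0.
apply: (@le_trans _ _ (\sum_(n <oo) (inner_content (U n))%:E)%E).
  apply: le_trans (inner_content_bigcup _); last by move=> n; have [] := UP n.
  rewrite lee_fin; apply: outer_content_le.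
    by apply: bigcup_open => n _; have [] := UP n.
  by move=> x [n _ Fx]; exists n => //; have [_ + _] := UP n; exact.
apply: lee_nneseries => n _; first by rewrite lee_fin inner_content_ge0.
by rewrite -EFinD lee_fin ltW//; have [] := UP n.
Qed.

HB.instance Definition _ := isOuterMeasure.Build R T regularization
  regularization0 regularization_ge0 regularization_mono regularization_subadditive.

(** For W open around X, nearly exhaust W meet U by a closed C, then W minus C by
    a closed D. Since C and D are disjoint closed subsets of W, additivity of m
    bounds the sum of the two pieces of X by the content of W. *)
Lemma open_caratheodory (U : set T) : open U -> (regularization.-caratheodory U)%classic.
Proof.
move=> oU; apply: le_caratheodory_measurable => X.
rewrite -EFinD lee_fin; apply: outer_content_ge => W oW XW.
apply/ler_addgt0Pr => e e0; have e2 : 0 < e / 2 by rewrite divr_gt0.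
have [C [cC CWU hC]] := inner_content_adherent (W `&` U) e2.
have [D [cD DWC hD]] := inner_content_adherent (W `\` C) e2.
have h1 : outer_content (X `&` U) <= inner_content (W `&` U).
  by apply: outer_content_le; [exact: openI|exact: setSI].
have h2 : outer_content (X `&` ~` U) <= inner_content (W `\` C).
  apply: outer_content_le; first by rewrite setDE; apply: openI => //; exact: closed_openC.
  by move=> x [Xx nU]; split; [exact: XW|move=> /CWU[]].
have h3 : m (C `|` D) <= inner_content W.
  apply: inner_content_ge; first exact: closedU.
  by move=> x [/CWU[]|/DWC[]].
have [_ _ mU] := m_fap; move: h3; rewrite mU; first lra.
by apply/seteqP; split => // x [Cx /DWC[]].
Qed.

Local Notation borelT := (g_sigma_algebraType (@open T)).

Lemma borel_caratheodory (A : set borelT) : measurable A ->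
  (regularization.-caratheodory A)%classic.
Proof.
apply: smallest_sub; last exact: open_caratheodory.
split; first exact: caratheodory_measurable_set0.
- by move=> B mB; rewrite setTD; exact: caratheodory_measurable_setC.
- exact: caratheodory_measurable_bigcup.
Qed.

Definition borel_regularization : set borelT -> \bar R := regularization.

Let borel_regularization_sigma_additive : semi_sigma_additive borel_regularization.
Proof.
move=> F mF tF mUF; apply: caratheodory_measure_sigma_additive => //.
  by move=> n; exact: borel_caratheodory (mF n).
exact: borel_caratheodory mUF.
Qed.

HB.instance Definition _ := isMeasure.Build _ borelT R borel_regularization
  regularization0 regularization_ge0 borel_regularization_sigma_additive.

Let borel_regularizationT : borel_regularization setT = 1%E.
Proof. by congr EFin; exact: outer_contentT. Qed.

HB.instance Definition _ :=
  Measure_isProbability.Build _ borelT R borel_regularization borel_regularizationT.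

(** Every open superset of a closed C has content at least m C, and this survives
    the infimum; the total mass stays 1 because the whole space is closed. *)
Lemma borel_probability_above_fap :
  exists eta : probability borelT R, forall C : set T, closed C -> ((m C)%:E <= eta C)%E.
Proof.
exists borel_regularization => C cC.
by rewrite lee_fin; exact: outer_content_closed.
Qed.

End Regularization.
(** * Powers and integrals of continuous functions *)

Lemma compact_bounded_above (R : realType) (T : ptopologicalType) (g : T -> R) :
  compact [set: T] -> continuous g -> exists c, forall t, g t <= c.
Proof.
move=> T_compact g_cont; have [|//||c _ c_max] := @compact_EVT_max T R g setT.
- by exists point.
- exact: continuous_subspaceT.
by exists (g c) => t; apply: c_max; rewrite inE.
Qed.

Section PowerContinuity.
Context {R : realType}.
Implicit Types x y c q : R.

Lemma powRVK c q : 0 < q -> 0 <= c -> (c `^ q^-1) `^ q = c.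
Proof. by move=> q0 c0; rewrite -powRrM mulVf ?gt_eqF// powRr1. Qed.

Lemma powR_mono_lt q x y : 0 < q -> 0 <= x -> 0 <= y ->
  (x `^ q < y `^ q) = (x < y).
Proof.
move=> q0 x0 y0; apply/idP/idP; last first.
  by apply: gt0_ltr_powR => //; rewrite ?inE.
apply: contraTT; rewrite -!leNgt.
by apply: ge0_ler_powR; rewrite ?inE//; exact: ltW.
Qed.

Lemma powR_mono_le q x y : 0 < q -> 0 <= x -> 0 <= y ->
  (x `^ q <= y `^ q) = (x <= y).
Proof. by move=> q0 x0 y0; rewrite !leNgt powR_mono_lt. Qed.

(** Continuity is read off the order: y |-> y^q is strictly increasing on the
    nonnegative numbers, so the preimage of an open ray is again an open ray,
    also at 0. *)
Lemma continuous_powR_comp (T : topologicalType) (f : T -> R) (q : R) : 0 < q ->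
  (forall t, 0 <= f t) -> continuous f -> continuous (fun t => f t `^ q).
Proof.
move=> q0 f0 f_cont t; apply/cvgrPdist_lt => e e0.
have upper : \forall t' \near t, f t' < (f t `^ q + e) `^ q^-1.
  apply: (f_cont t [set y | y < _]); apply: lt_nbhsl.
  rewrite -(powR_mono_lt q0)// ?powR_ge0// powRVK ?ltrDl//.
  by rewrite addr_ge0 ?powR_ge0// ltW.
have lower : \forall t' \near t, f t `^ q - e < f t' `^ q.
  have [neg|pos] := ltP (f t `^ q - e) 0.
    by apply: nearW => t'; apply: lt_le_trans neg _; exact: powR_ge0.
  have : \forall t' \near t, (f t `^ q - e) `^ q^-1 < f t'.
    apply: (f_cont t [set y | _ < y]); apply: lt_nbhsr.
    by rewrite -(powR_mono_lt q0)// ?powR_ge0// powRVK// ltrBlDr ltrDl.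
  apply: filterS => t'.
  by rewrite -(powR_mono_lt q0) ?powR_ge0// powRVK.
apply: filterS2 upper lower => t' h1 h2.
rewrite -(powR_mono_lt q0) ?powR_ge0// powRVK// in h1; last first.
  by rewrite addr_ge0 ?powR_ge0// ltW.
by rewrite ltr_norml; apply/andP; split; lra.
Qed.

End PowerContinuity.

Section BorelIntegral.
Context {R : realType} {T : ptopologicalType}.
Local Notation borelT := (g_sigma_algebraType (@open T)).

Lemma open_borel (U : set T) : open U -> measurable (U : set borelT).
Proof. exact: sub_sigma_algebra. Qed.

Lemma closed_borel (C : set T) : closed C -> measurable (C : set borelT).
Proof.
by move=> cC; rewrite -[C]setCK; apply: measurableC; exact: open_borel (closed_openC cC).
Qed.

Lemma continuous_borel_measurable (f : T -> R) : continuous f ->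
  measurable_fun [set: borelT] (f : borelT -> R).
Proof.
move=> f_cont; apply: (measurability _ (RGenOInfty.measurableE R)).
move=> _ [_ [a ->] <-]; rewrite setTI; apply: open_borel.
have := @open_comp T R f [set x | a < x].
rewrite preimage_itvoy; apply; first by move=> t _; exact: f_cont.
exact: open_gt.
Qed.

Variable eta : probability borelT R.

Lemma bounded_borel_integrable (f : T -> R) (c : R) : continuous f ->
  (forall t, `|f t| <= c) -> eta.-integrable [set: borelT] (EFin \o f).
Proof.
move=> f_cont f_le.
apply: measurable_bounded_integrable => //.
- by rewrite (le_lt_trans (probability_le1 _ _))// ltry.
- exact: continuous_borel_measurable.
- by exists c; split; [exact: num_real|move=> d cd t _; exact: le_trans (f_le t) (ltW cd)].
Qed.

(** The step function sum_k e * 1_(x >= (k+1)e) approximates x from below up to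
    e. It involves closed superlevel sets only, the sets on which the measure
    is known to dominate. *)
Lemma layer_cake_le (e x : R) (N : nat) : 0 < e -> 0 <= x ->
  \sum_(0 <= k < N) e * ((k.+1%:R * e <= x)%R : nat)%:R <= x.
Proof.
move=> e0 x0.
suff : \sum_(0 <= k < N) e * ((k.+1%:R * e <= x)%R : nat)%:R <= x /\
    \sum_(0 <= k < N) e * ((k.+1%:R * e <= x)%R : nat)%:R <= N%:R * e by case.
elim: N => [|N [IH1 IH2]]; first by rewrite big_geq// mul0r.
rewrite big_nat_recr//=; have [h|h] := leP (N.+1%:R * e) x.
  by rewrite mulr1; split; move: h IH1 IH2; rewrite -natr1 mulrDl mul1r; lra.
rewrite mulr0 addr0; split=> //; apply: le_trans IH2 _.
by rewrite -natr1 mulrDl mul1r lerDl ltW.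
Qed.

Lemma layer_cake_ge (e x : R) (N : nat) : 0 < e -> x <= N%:R * e ->
  x <= e + \sum_(0 <= k < N) e * ((k.+1%:R * e <= x)%R : nat)%:R.
Proof.
move=> e0.
have full M : M%:R * e <= x ->
    \sum_(0 <= k < M) e * ((k.+1%:R * e <= x)%R : nat)%:R = M%:R * e.
  elim: M => [|M IH] Mx; first by rewrite big_geq// mul0r.
  rewrite big_nat_recr//= Mx mulr1 IH; first by rewrite -natr1 mulrDl mul1r.
  by apply: le_trans Mx; rewrite ler_pM2r// ler_nat.
elim: N => [|N IH] xN.
  by rewrite big_geq// addr0; apply: le_trans xN _; rewrite mul0r ltW.
have [h|h] := leP x (N%:R * e).
  apply: le_trans (IH h) _; rewrite big_nat_recr//= addrA lerDl.
  by rewrite mulr_ge0// ltW.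
rewrite big_nat_recr//= full ?(ltW h)// addrA; apply: (le_trans xN).
by rewrite -natr1 mulrDl mul1r [N%:R * e + e]addrC lerDl mulr_ge0// ltW.
Qed.

(** Passing from a positive functional to a measure loses nothing for
    nonnegative continuous functions: their superlevel sets are closed, and on
    closed sets the measure is at least the functional. *)
Lemma functional_le_integral (L : bounded_fun R T -> R) (f : bounded_fun R T) :
  (forall u v, L (u + v) = L u + L v) ->
  (forall (a : R) v, L (a *: v) = a * L v) ->
  (forall (h : bounded_fun R T) (c : R), (forall t, h t <= c) -> L h <= c) ->
  (forall (C : set T) (chi : bounded_fun R T), closed C ->
    (forall t, chi t = \1_C t) -> ((L chi)%:E <= eta C)%E) ->
  continuous (f : T -> R) -> (forall t, 0 <= f t) ->
  L f <= \int[eta]_(t in [set: borelT]) f t.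
Proof.
move=> LD LZ L_le L_eta f_cont f0; apply/ler_addgt0Pl => e e0.
have [c fc] := bounded_funP f.
have [N cN] : exists N : nat, c <= N%:R * e.
  exists (Num.bound `|c / e|); rewrite -ler_pdivrMr//.
  by apply: (le_trans (ler_norm _)); apply: ltW; exact: archi_boundP.
pose C k := [set t | k.+1%:R * e <= f t].
have C_closed k : closed (C k).
  have := @preimage_closed T R (f : T -> R) [set x | k.+1%:R * e <= x].
  by apply; [move=> t _; exact: f_cont|exact: closed_ge].
have chi_bounded k : (\1_(C k) : T -> R^o) \in bounded_pred.
  by rewrite inE; exists 1 => t; rewrite indicE normr_nat lern1 leq_b1.
pose chi k := BoundedFun (chi_bounded k).
have addE (u v : bounded_fun R T) t : (u + v) t = u t + v t by [].
have scaleE (a : R) (u : bounded_fun R T) t : (a *: u) t = a * u t by [].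
have indE k t : \1_(C k) t = ((k.+1%:R * e <= f t)%R : nat)%:R :> R.
  by rewrite indicE; congr (_%:R); congr nat_of_bool; apply/asboolP/idP.
have L_sum (g : nat -> bounded_fun R T) : L (\sum_(0 <= k < N) g k) = \sum_(0 <= k < N) L (g k).
  have L0 : L 0 = 0 by have := LZ 0 0; rewrite scale0r mul0r.
  by elim/big_rec2 : _ => // k y z _ <-; rewrite LD.
have sumE t : (\sum_(0 <= k < N) (e *: chi k) : bounded_fun R T) t =
    \sum_(0 <= k < N) e * ((k.+1%:R * e <= f t)%R : nat)%:R.
  elim/big_rec2 : _ => // k y z _ <- /=.
  by rewrite -indE.
have step1 : L f <= e + \sum_(0 <= k < N) e * L (chi k).
  under eq_bigr do rewrite -LZ.
  rewrite -L_sum -lerBlDr.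
  have -> : L f - L (\sum_(0 <= k < N) (e *: chi k)) =
      L (f + (-1) *: \sum_(0 <= k < N) (e *: chi k)) by rewrite LD LZ mulN1r.
  apply: L_le => t; rewrite addE scaleE mulN1r lerBlDr sumE; apply: layer_cake_ge => //.
  by apply: le_trans cN; apply: le_trans (fc t); exact: ler_norm.
have f_int := bounded_borel_integrable f_cont fc.
have int_ge : ((\sum_(0 <= k < N) e * L (chi k))%:E <=
    \int[eta]_(t in [set: borelT]) (f t)%:E)%E.
  have chi_meas k : measurable_fun [set: borelT] (fun t => (e * \1_(C k) t)%:E).
    apply/measurable_EFinP; apply: measurable_funM => //.
    by apply: measurable_indic; exact: closed_borel.
  have chi_ge0 k t : (0 <= (e * \1_(C k) t)%:E)%E by rewrite lee_fin mulr_ge0// ltW.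
  apply: (@le_trans _ _ (\int[eta]_(t in [set: borelT])
      (\sum_(0 <= k < N) (e * \1_(C k) t)%:E))%E); last first.
    apply: ge0_le_integral => //.
    - by move=> t _; exact: sume_ge0.
    - exact: (emeasurable_sum _ chi_meas).
    - apply/measurable_EFinP.
      exact: continuous_borel_measurable.
    - move=> t _; rewrite sumEFin lee_fin.
      under eq_bigr do rewrite indE.
      exact: layer_cake_le.
  rewrite ge0_integral_sum// -sumEFin; apply: lee_sum => k _.
  under eq_integral do rewrite EFinM.
  rewrite ge0_integralZl_EFin ?(ltW e0)//; last first.
    by apply/measurable_EFinP; apply: measurable_indic; exact: closed_borel.
  rewrite integral_indic ?setIT//; last exact: closed_borel.
  rewrite EFinM; apply: lee_wpmul2l; first by rewrite lee_fin ltW.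
  exact: L_eta.
have int_fin : (\int[eta]_(t in [set: borelT]) (f t)%:E)%E \is a fin_num.
  exact: integrable_fin_num.
rewrite /Rintegral (le_trans step1)// lerD2l -lee_fin fineK//.
Qed.
End BorelIntegral.
(** * Domination by a Borel probability *)

Section ContinuousOnBall.
Context {R : realType} {s : scalar_kind}.
Local Notation K := (scalar_field R s).
Variable X : normedModType K.

Lemma cont_ball_nrm_continuous (f : cont_ball X) :
  continuous (fun b : dual_ball X => nrm (f b) : R).
Proof.
have := cont_funP f; rewrite inE => f_cont b.
apply: (@continuous_comp (dual_ball X) K^o R f); first exact: f_cont.
exact: nrm_continuous.
Qed.

Lemma nrm_le_sup_norm (f : cont_ball X) (b : dual_ball X) : nrm (f b) <= sup_norm f.
Proof.
have [c fc] := compact_bounded_above (@dual_ball_compact _ _ X) (cont_ball_nrm_continuous (f := f)).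
apply: ub_le_sup; last by exists b.
by exists c => _ [b' _ <-]; exact: fc.
Qed.

Lemma sup_norm_le (f : dual_ball X -> K) (c : R) : (forall b, nrm (f b) <= c) ->
  sup_norm f <= c.
Proof.
move=> fc; apply: ge_sup; first by exists (nrm (f point)), point.
by move=> _ [b _ <-]; exact: fc.
Qed.

Lemma to_hat_linear (a : K) (x y : X) : to_hat (a *: x + y) = a *: to_hat x + to_hat y.
Proof. by apply/val_inj => /=; rewrite linearP. Qed.

Lemma to_hat0 : to_hat (0 : X) = 0.
Proof. by apply/val_inj => /=; rewrite linear0. Qed.

Lemma to_hatZ (a : K) (x : X) : to_hat (a *: x) = a *: to_hat x.
Proof. by have := to_hat_linear a x 0; rewrite addr0 to_hat0 addr0. Qed.

Section PowerSums.
Variables (Phi : hat X -> cont_ball X) (p : R).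
Hypothesis p1 : 1 <= p.

Let p0 : 0 < p. Proof. exact: lt_le_trans p1. Qed.

Lemma p_pow_continuous (x : X) :
  continuous (fun b : dual_ball X => nrm (Phi (to_hat x) b) `^ p).
Proof.
apply: continuous_powR_comp => //; last exact: cont_ball_nrm_continuous.
by move=> b; exact: nrm_ge0.
Qed.

Lemma p_pow_sum_continuous (n : nat) (x : 'I_n -> X) :
  continuous (fun b : dual_ball X => \sum_(i < n) nrm (Phi (to_hat (x i)) b) `^ p).
Proof.
elim: (index_enum 'I_n) => [|i r IH].
  rewrite (_ : (fun _ => _) = (fun=> 0)); first exact: cst_continuous.
  by apply/funext => b; rewrite big_nil.
rewrite (_ : (fun _ => _) = (fun b => nrm (Phi (to_hat (x i)) b) `^ p +
    \sum_(j <- r) nrm (Phi (to_hat (x j)) b) `^ p)).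
  move=> b; apply: (@cvgD R R^o _ (nbhs b) _ (fun b => nrm (Phi (to_hat (x i)) b) `^ p)).
    exact: p_pow_continuous.
  exact: IH.
by apply/funext => b; rewrite big_cons.
Qed.

Lemma p_pow_sum_ge0 (n : nat) (x : 'I_n -> X) (b : dual_ball X) :
  0 <= \sum_(i < n) nrm (Phi (to_hat (x i)) b) `^ p.
Proof. by apply: sumr_ge0 => i _; exact: powR_ge0. Qed.

Lemma nrm_p_sum (n : nat) (x : 'I_n -> X) (b : dual_ball X) :
  nrm (p_sum Phi p x b) = (\sum_(i < n) nrm (Phi (to_hat (x i)) b) `^ p) `^ p^-1.
Proof. by rewrite /p_sum nrm_of_real ger0_norm// powR_ge0. Qed.

End PowerSums.
End ContinuousOnBall.

Section Domination.
Context {R : realType} {s : scalar_kind}.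
Local Notation K := (scalar_field R s).
Variables (X Y : normedModType K) (p : R) (T : {linear X -> Y}).
Variable Phi : hat X -> cont_ball X.
Hypothesis p1 : 1 <= p.
Hypothesis Phi_homogeneous : pos_homogeneous Phi.

Let p0 : 0 < p. Proof. exact: lt_le_trans p1. Qed.

(** For k the p-th power of the summing constant, these functions form a convex
    cone as the finite family x varies, and the summing inequality says that
    none of them lies below a negative constant. *)
Definition excess (k : R) (n : nat) (x : 'I_n -> X) (b : dual_ball X) : R :=
  k * (\sum_(i < n) nrm (Phi (to_hat (x i)) b) `^ p) - \sum_(i < n) nrm (T (x i)) `^ p.

Definition append n m (x : 'I_n -> X) (y : 'I_m -> X) (i : 'I_(n + m)) : X :=
  match fintype.split i with inl j => x j | inr j => y j end.

Lemma excess_add k n m (x : 'I_n -> X) (y : 'I_m -> X) b :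
  excess k (append x y) b =
  excess k x b + excess k y b.
Proof.
rewrite /excess /append !big_split_ord/=.
have eL (i : 'I_n) : fintype.split (lshift m i) = inl i by exact: (unsplitK (inl i)).
have eR (i : 'I_m) : fintype.split (rshift n i) = inr i by exact: (unsplitK (inr i)).
under [in LHS]eq_bigr do rewrite eL.
under [X in k * (_ + X)]eq_bigr do rewrite eR.
under [X in _ - (X + _)]eq_bigr do rewrite eL.
under [X in _ - (_ + X)]eq_bigr do rewrite eR.
by rewrite mulrDr opprD addrACA.
Qed.

Lemma excess_scale k n (x : 'I_n -> X) (a : R) b : 0 < a ->
  excess k (fun i => of_real (a `^ p^-1) *: x i) b = a * excess k x b.
Proof.
move=> a0; have c0 : 0 < a `^ p^-1 by exact: powR_gt0.
rewrite /excess mulrBr mulrCA; congr (k * _ - _); rewrite mulr_sumr; apply: eq_bigr => i _.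
  rewrite to_hatZ Phi_homogeneous// (_ : (_ *: _ : cont_ball X) b =
    of_real (a `^ p^-1) * Phi (to_hat (x i)) b)//.
  by rewrite nrmM nrm_of_real gtr0_norm// powRM ?nrm_ge0 ?powR_ge0// powRVK// ltW.
rewrite linearZ nrmZ nrm_of_real gtr0_norm// powRM ?nrm_ge0 ?powR_ge0//.
by rewrite powRVK// ltW.
Qed.

(** The Pietsch domination theorem for Phi. The separating functional, restricted
    to indicators, is a finitely additive probability; passing to its Borel
    regularization can only increase the value at the nonnegative continuous
    functions |Phi(x)|^p. *)
Theorem pietsch_domination (k : R) : 0 < k ->
  (forall (n : nat) (x : 'I_n -> X),
    (\sum_(i < n) nrm (T (x i)) `^ p) `^ p^-1 <= k * sup_norm (p_sum Phi p x)) ->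
  exists eta : probability (borel_ball X) R,
    forall x : X, nrm (T x) <= k * p_mean Phi p eta x.
Proof.
move=> k0 summing.
pose P : set (bounded_fun R (dual_ball X)) := [set g | exists (n : nat) (x : 'I_n -> X),
  forall b, g b = excess (k `^ p) x b].
have kp0 : 0 < k `^ p by exact: powR_gt0.
have [||||L [LD LZ L_le L_P]] := @cone_positive_functional R (dual_ball X) P.
- exists 0, (fun=> 0) => b; rewrite /excess !big_ord0 mulr0 subr0//.
- move=> g h [n [x gx]] [m [y hy]].
  exists (n + m)%N, (append x y) => b.
  by rewrite excess_add -gx -hy.
- move=> a g a0 [n [x gx]]; exists n, (fun i => of_real (a `^ p^-1) *: x i) => b.
  by rewrite (excess_scale _ _ _ a0) -gx.
- move=> g c [n [x gx]] gc.
  set S := \sum_(i < n) nrm (T (x i)) `^ p.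
  have S0 : 0 <= S by apply: sumr_ge0 => i _; exact: powR_ge0.
  have le_c b : \sum_(i < n) nrm (Phi (to_hat (x i)) b) `^ p <= (c + S) / k `^ p.
    rewrite ler_pdivlMr// mulrC -lerBlDr; have := gc b; rewrite gx /excess -/S; lra.
  have cS0 : 0 <= (c + S) / k `^ p.
    by apply: le_trans (le_c point); exact: p_pow_sum_ge0.
  suff : S <= c + S by lra.
  have : S `^ p^-1 <= k * ((c + S) / k `^ p) `^ p^-1.
    apply: (le_trans (summing n x)); rewrite ler_pM2l//; apply: sup_norm_le => b.
    rewrite nrm_p_sum powR_mono_le ?invr_gt0// p_pow_sum_ge0//.
  rewrite -(powR_mono_le p0) ?powR_ge0// ?mulr_ge0 ?powR_ge0 ?(ltW k0)//.
  rewrite powRVK// powRM ?powR_ge0 ?(ltW k0)// powRVK//.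
  by rewrite mulrC divfK ?gt_eqF.
have chi_bounded (A : set (dual_ball X)) : (\1_A : dual_ball X -> R^o) \in bounded_pred.
  by rewrite inE; exists 1 => t; rewrite indicE normr_nat lern1 leq_b1.
pose chi A := BoundedFun (chi_bounded A); pose m A := L (chi A).
have L_ge (h : bounded_fun R (dual_ball X)) (c : R) : (forall t, c <= h t) -> c <= L h.
  move=> hc; have := L_le (-1 *: h) (- c); rewrite LZ mulN1r lerN2; apply => t.
  by rewrite (_ : (_ *: _ : bounded_fun _ _) t = -1 * h t)// mulN1r lerN2.
have m_fap : finitely_additive_probability m.
  split.
  - by move=> A; apply: L_ge => t; rewrite /= indicE ler0n.
  - apply/eqP; rewrite eq_le; apply/andP; split.
      by apply: L_le => t; rewrite /= indicE lern1 leq_b1.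
    by apply: L_ge => t; rewrite /= indicT.
  - move=> A B AB; rewrite -LD; congr L; apply/val_inj/funext => t.
    change (\1_(A `|` B) t = \1_A t + \1_B t :> R).
    rewrite !indicE in_setU.
    have : ~ (t \in A /\ t \in B).
      by rewrite !inE => tAB; have : (A `&` B) t by []; rewrite AB.
    by case: (t \in A); case: (t \in B) => // h;
      rewrite ?addr0 ?add0r//; exfalso; exact: h.
have [eta eta_ge] := borel_probability_above_fap (@dual_ball_compact _ _ X)
  (@dual_ball_hausdorff _ _ X) m_fap.
exists eta => x.
have f_bounded : (fun b : dual_ball X => nrm (Phi (to_hat x) b) `^ p : R^o) \in bounded_pred.
  have [c hc] := compact_bounded_above (@dual_ball_compact _ _ X) (p_pow_continuous (Phi := Phi) p1 (x := x)).
  by rewrite inE; exists c => b; rewrite ger0_norm// powR_ge0.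
pose f := BoundedFun f_bounded.
have f_le : L f <= \int[eta]_(b in [set: borel_ball X]) f b.
  apply: functional_le_integral => //.
  - move=> C c cC cE; rewrite (_ : c = chi C); first exact: eta_ge.
    by apply/val_inj/funext.
  - exact: p_pow_continuous.
  - by move=> b; exact: powR_ge0.
have T_le : nrm (T x) `^ p <= k `^ p * L f.
  have := L_P (k `^ p *: f + (- nrm (T x) `^ p) *: chi setT).
  rewrite LD !LZ.
  have -> : L (chi setT) = 1 by case: m_fap.
  rewrite mulr1 subr_ge0; apply; exists 1, (fun=> x) => b.
  rewrite /excess !big_ord1 (_ : (_ + _ : bounded_fun _ _) b =
    k `^ p * f b + - nrm (T x) `^ p * \1_setT b)//.
  by rewrite indicT mulr1.
rewrite -(powR_mono_le p0) ?nrm_ge0 ?mulr_ge0 ?powR_ge0 ?(ltW k0)//.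
have int_ge0 : 0 <= \int[eta]_(b in [set: borel_ball X]) f b.
  by apply: Rintegral_ge0 => b _; exact: powR_ge0.
rewrite powRM ?powR_ge0 ?(ltW k0)// /p_mean powRVK//.
by apply: (le_trans T_le); rewrite ler_pM2l.
Qed.

End Domination.
(** * Quotient and completion of a seminormed space *)

Local Open Scope quotient_scope.

Section SeminormQuotient.
Context {R : realType} {s : scalar_kind}.
Local Notation K := (scalar_field R s).
Variables (V : lmodType K) (q : V -> R).
Hypothesis q_semi : seminorm q.

Lemma seminorm0 : q 0 = 0.
Proof. by have := q_semi.2 0 0; rewrite scale0r nrm0 mul0r. Qed.

Lemma seminormN v : q (- v) = q v.
Proof.
have := q_semi.2 (-1) v; rewrite scaleN1r nrmN -(of_real1 (R := R)) nrm_of_real.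
by rewrite normr1 mul1r.
Qed.

Lemma seminorm_ge0 v : 0 <= q v.
Proof.
have := q_semi.1 v (- v); rewrite subrr seminorm0 seminormN; lra.
Qed.

Lemma seminormBC u v : q (u - v) = q (v - u).
Proof. by rewrite -seminormN opprB. Qed.

Lemma seminorm_triangle u v w : q (u - w) <= q (u - v) + q (v - w).
Proof.
have -> : u - w = (u - v) + (v - w) by rewrite addrA subrK.
exact: q_semi.1.
Qed.

Lemma seminorm_sub_eq0 u v : q (u - v) = 0 -> q u = q v.
Proof.
move=> uv; have := seminorm_triangle u v 0; have := seminorm_triangle v u 0.
by rewrite !subr0 (seminormBC v) uv; lra.
Qed.

Definition null_rel : rel V := fun u v => q (u - v) == 0.

Fact null_rel_refl : reflexive null_rel.
Proof. by move=> u; rewrite /null_rel subrr seminorm0. Qed.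

Fact null_rel_sym : symmetric null_rel.
Proof. by move=> u v; rewrite /null_rel seminormBC. Qed.

Fact null_rel_trans : transitive null_rel.
Proof.
move=> v u w /eqP uv /eqP vw; apply/eqP.
have := seminorm_triangle u v w; have := seminorm_ge0 (u - w); lra.
Qed.

Canonical null_equiv := EquivRel null_rel null_rel_refl null_rel_sym null_rel_trans.

Definition seminorm_quotient := {eq_quot null_equiv}.

HB.instance Definition _ := Choice.on seminorm_quotient.
HB.instance Definition _ := EqQuotient.on seminorm_quotient.

Definition quotient_map (v : V) : seminorm_quotient := \pi v.

Lemma quotient_map_eq u v : quotient_map u = quotient_map v <-> q (u - v) = 0.
Proof. 
split=> [/eqmodP/eqP//|uv]; apply/eqmodP/eqP; exact: uv.
Qed.

Lemma quotient_map_surj w : exists v, quotient_map v = w.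
Proof. by exists (repr w); exact: reprK. Qed.

Lemma seminorm_repr v : q (repr (quotient_map v) - v) = 0.
Proof. by apply/quotient_map_eq; exact: reprK. Qed.

(* Operations are computed on chosen representatives; the three equations below
   are their independence of the choice. *)
Let qadd (a b : seminorm_quotient) := quotient_map (repr a + repr b).
Let qopp (a : seminorm_quotient) := quotient_map (- repr a).
Let qscale (k : K) (a : seminorm_quotient) := quotient_map (k *: repr a).

Let qaddE u v : qadd (quotient_map u) (quotient_map v) = quotient_map (u + v).
Proof.
apply/quotient_map_eq; rewrite opprD addrACA.
have := q_semi.1 (repr (quotient_map u) - u) (repr (quotient_map v) - v).
rewrite !seminorm_repr addr0.
have := seminorm_ge0 (repr (quotient_map u) - u + (repr (quotient_map v) - v)); lra.
Qed.

Let qoppE u : qopp (quotient_map u) = quotient_map (- u).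
Proof. by apply/quotient_map_eq; rewrite -opprD seminormN seminorm_repr. Qed.

Let qscaleE k u : qscale k (quotient_map u) = quotient_map (k *: u).
Proof. by apply/quotient_map_eq; rewrite -scalerBr q_semi.2 seminorm_repr mulr0. Qed.

Let qaddA : associative qadd.
Proof.
move=> a b c.
have [u <-] := quotient_map_surj a; have [v <-] := quotient_map_surj b.
by have [w <-] := quotient_map_surj c; rewrite !qaddE addrA.
Qed.

Let qaddC : commutative qadd.
Proof. by move=> a b; rewrite /qadd addrC. Qed.

Let qadd0 : left_id (quotient_map 0) qadd.
Proof. by move=> a; have [u <-] := quotient_map_surj a; rewrite qaddE add0r. Qed.

Let qaddN : left_inverse (quotient_map 0) qopp qadd.
Proof. by move=> a; have [u <-] := quotient_map_surj a; rewrite qoppE qaddE addNr. Qed.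

HB.instance Definition _ := GRing.isZmodule.Build seminorm_quotient
  qaddA qaddC qadd0 qaddN.

Let qscaleA a b v : qscale a (qscale b v) = qscale (a * b) v.
Proof. by have [u <-] := quotient_map_surj v; rewrite !qscaleE scalerA. Qed.

Let qscale1 : left_id 1 qscale.
Proof. by move=> a; have [u <-] := quotient_map_surj a; rewrite qscaleE scale1r. Qed.

Let qscaleDr : right_distributive qscale +%R.
Proof.
move=> k a b; have [u <-] := quotient_map_surj a; have [v <-] := quotient_map_surj b.
by rewrite [_ + _]qaddE !qscaleE [RHS]qaddE scalerDr.
Qed.

Let qscaleDl v : {morph qscale^~ v : a b / a + b}.
Proof.
move=> a b; have [u <-] := quotient_map_surj v.
by rewrite !qscaleE [RHS]qaddE scalerDl.
Qed.

HB.instance Definition _ := GRing.Zmodule_isLmodule.Build K seminorm_quotient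
  qscaleA qscale1 qscaleDr qscaleDl.

Lemma quotient_map_linear : linear quotient_map.
Proof. by move=> k u v; rewrite [k *: quotient_map u]qscaleE [RHS]qaddE. Qed.

HB.instance Definition _ := GRing.isLinear.Build K V seminorm_quotient *:%R
  quotient_map quotient_map_linear.

Definition quotient_norm (a : seminorm_quotient) : K := of_real (q (repr a)).

Let quotient_normE v : quotient_norm (quotient_map v) = of_real (q v).
Proof. by congr of_real; apply: seminorm_sub_eq0; exact: seminorm_repr. Qed.

Let quotient_normD a b : quotient_norm (a + b) <= quotient_norm a + quotient_norm b.
Proof.
have [u <-] := quotient_map_surj a; have [v <-] := quotient_map_surj b.
by rewrite -linearD !quotient_normE -of_realD le_of_real; exact: q_semi.1.
Qed.

Let quotient_normZ k a : quotient_norm (k *: a) = `|k| * quotient_norm a.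
Proof.
have [u <-] := quotient_map_surj a.
by rewrite -linearZ !quotient_normE q_semi.2 of_realM norm_of_real.
Qed.

Let quotient_norm_eq0 a : quotient_norm a = 0 -> a = 0.
Proof.
have [u <-] := quotient_map_surj a; rewrite quotient_normE => u0.
rewrite -(linear0 quotient_map); apply/quotient_map_eq; rewrite subr0.
by rewrite -[q u](of_realK (s := s)) u0 -of_real0 of_realK.
Qed.

HB.instance Definition _ := Lmodule_isNormed.Build K seminorm_quotient
  quotient_normD quotient_normZ quotient_norm_eq0.

Lemma nrm_quotient_map v : nrm (quotient_map v) = q v.
Proof. by rewrite /nrm -[RHS](of_realK (s := s)) -quotient_normE. Qed.

End SeminormQuotient.

Section CauchySequences.
Context {R : realType} {s : scalar_kind}.
Local Notation K := (scalar_field R s).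
Variables (V : lmodType K) (q : V -> R).
Hypothesis q_semi : seminorm q.

Definition cauchy_pred : {pred nat -> V} := mem [set u : nat -> V |
  forall e : R, 0 < e -> exists N : nat, forall m n : nat,
    (N <= m)%N -> (N <= n)%N -> q (u m - u n) < e].

Fact cauchy_submod_closed : submod_closed cauchy_pred.
Proof.
split=> [|a u v]; rewrite !inE /=.
  by move=> e e0; exists 0%N => m n _ _; rewrite subrr (seminorm0 q_semi).
move=> u_cau v_cau e e0; pose d := e / (1 + nrm a).
have a0 := nrm_ge0 a.
have d0 : 0 < d by rewrite divr_gt0//; lra.
have [N1 h1] := u_cau _ d0; have [N2 h2] := v_cau _ d0.
exists (maxn N1 N2) => m n; rewrite !geq_max => /andP[m1 m2] /andP[n1 n2] /=.
rewrite opprD addrACA -scalerBr; apply: (le_lt_trans (q_semi.1 _ _)).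
have -> : e = nrm a * d + d by rewrite /d; field; lra.
by rewrite q_semi.2; apply: ler_ltD; [rewrite ler_wpM2l// ltW// h1|exact: h2].
Qed.

HB.instance Definition _ := GRing.isSubmodClosed.Build K (nat -> V)
  cauchy_pred cauchy_submod_closed.

Record cauchy_sequence := CauchySequence {
  cauchy_val :> nat -> V;
  cauchy_valP : cauchy_val \in cauchy_pred }.

HB.instance Definition _ := [isSub for cauchy_val].
HB.instance Definition _ := [Choice of cauchy_sequence by <:].
HB.instance Definition _ := [SubChoice_isSubLmodule of cauchy_sequence by <:].

Lemma cauchy_sequenceP (u : cauchy_sequence) (e : R) : 0 < e ->
  exists N : nat, forall m n : nat, (N <= m)%N -> (N <= n)%N -> q (u m - u n) < e.
Proof. by have := cauchy_valP u; rewrite inE /= => h e0; exact: h. Qed.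

Lemma seminorm_dist u v : `|q u - q v| <= q (u - v).
Proof.
have h w w' : q w - q w' <= q (w - w').
  by have := q_semi.1 (w - w') w'; rewrite subrK; lra.
by rewrite ler_norml lerNl opprB {1}(seminormBC q_semi) !h.
Qed.

Definition limit_seminorm (u : cauchy_sequence) : R := lim (q (u n) @[n --> \oo]).

Lemma limit_seminorm_cvg (u : cauchy_sequence) :
  q (u n) @[n --> \oo] --> limit_seminorm u.
Proof.
have [|l ql] := @scalar_complete R RealScalars (fun n => q (u n)).
  move=> e e0; have [N uN] := cauchy_sequenceP u e0; exists N => m n Nm Nn.
  exact: le_lt_trans (seminorm_dist _ _) (uN _ _ Nm Nn).
suff : cvg (q (u n) @[n --> \oo]) by [].
apply/cvg_ex; exists l; apply/cvgrPdist_lt => e e0.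
have [N h] := ql _ e0; exists N => // n Nn /=.
by rewrite distrC; exact: h.
Qed.

Lemma limit_seminorm_le (u : cauchy_sequence) (c : R) (N : nat) :
  (forall n, (N <= n)%N -> q (u n) <= c) -> limit_seminorm u <= c.
Proof.
move=> uc; apply: limr_le; first exact: limit_seminorm_cvg.
by exists N.
Qed.

Lemma limit_seminormP : seminorm limit_seminorm.
Proof.
split=> [u v|a u].
  have uv := cvgD (@limit_seminorm_cvg u) (@limit_seminorm_cvg v).
  have le_n n : q ((u + v) n) <= q (u n) + q (v n) by exact: q_semi.1.
  exact: (ler_cvg_to (@limit_seminorm_cvg (u + v)) (uv _) (nearW _ le_n)).
apply: (cvg_unique _ (@limit_seminorm_cvg (a *: u))) => //.
rewrite (_ : (fun n => q _) = (fun n => nrm a * q (u n))).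
  apply: cvgMr; exact: limit_seminorm_cvg.
by apply/funext => n; exact: q_semi.2.
Qed.

(** The kernel of the limit seminorm consists of the null sequences, so this
    quotient is the usual completion by Cauchy sequences. *)
Definition seminorm_completion := seminorm_quotient limit_seminormP.

HB.instance Definition _ := NormedModule.on seminorm_completion.

Fact constant_cauchy (v : V) : (fun _ : nat => v) \in cauchy_pred.
Proof.
by rewrite inE => e e0; exists 0%N => m n _ _; rewrite subrr (seminorm0 q_semi).
Qed.

Definition completion_embed (v : V) : seminorm_completion :=
  quotient_map limit_seminormP (CauchySequence (constant_cauchy v)).

Lemma completion_embed_linear : linear completion_embed.
Proof.
move=> a u v; rewrite /completion_embed -linearP; congr (quotient_map _).
by apply/val_inj/funext.
Qed.

HB.instance Definition _ := GRing.isLinear.Build K V seminorm_completion *:%R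
  completion_embed completion_embed_linear.

Lemma limit_seminorm_dist (u v : cauchy_sequence) (c : R) (N : nat) :
  (forall n, (N <= n)%N -> q (u n - v n) <= c) ->
  nrm (quotient_map limit_seminormP u - quotient_map limit_seminormP v) <= c.
Proof.
move=> h; rewrite -linearB nrm_quotient_map.
exact: (@limit_seminorm_le _ _ N).
Qed.

Lemma nrm_completion_embed v : nrm (completion_embed v) = q v.
Proof.
rewrite nrm_quotient_map.
have := @limit_seminorm_cvg (CauchySequence (constant_cauchy v)) => /= lim_v.
have cst_v : (fun _ : nat => q v) @ \oo --> q v by exact: cvg_cst.
exact: (cvg_unique _ lim_v cst_v).
Qed.

Lemma completion_embed_dense (x : seminorm_completion) (e : R) : 0 < e ->
  exists v, nrm (x - completion_embed v) < e.
Proof.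
move=> e0; have [u <-] := quotient_map_surj x.
have e2 : 0 < e / 2 by rewrite divr_gt0.
have [N uN] := cauchy_sequenceP u e2; exists (u N).
have : e / 2 < e by lra.
apply: le_lt_trans; apply: (@limit_seminorm_dist _ _ _ N) => n Nn /=.
by apply: ltW; exact: uN.
Qed.

Lemma completion_embed_limit (u : cauchy_sequence) (e : R) : 0 < e ->
  exists N, forall n, (N <= n)%N ->
    nrm (quotient_map limit_seminormP u - completion_embed (u n)) < e.
Proof.
move=> e0; have e2 : 0 < e / 2 by rewrite divr_gt0.
have [N uN] := cauchy_sequenceP u e2; exists N => n Nn.
have : e / 2 < e by lra.
apply: le_lt_trans; apply: (@limit_seminorm_dist _ _ _ N) => m Nm /=.
by apply: ltW; exact: uN.
Qed.

(** Density reduces a Cauchy filter on the completion to a Cauchy sequence in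
    V, which is itself a point of the completion. *)
Lemma seminorm_completion_complete (F : set_system seminorm_completion) :
  ProperFilter F -> cauchy F -> cvg F.
Proof.
move=> FF /cauchyP F_cau.
have near_V n : exists v, F [set x | nrm (completion_embed v - x) < n.+1%:R^-1].
  have : 0 < n.+1%:R^-1 :> R by [].
  move: (_^-1) => d d0; have n0 : 0 < d / 2 by rewrite divr_gt0.
  have n0K : 0 < of_real (d / 2) :> K by rewrite -of_real0 lt_of_real.
  have [x Fx] := F_cau _ n0K.
  have [v xv] := completion_embed_dense x n0; exists v.
  apply: filterS Fx => y; rewrite ball_nrm => xy /=.
  have -> : completion_embed v - y = (completion_embed v - x) + (x - y).
    by rewrite addrA subrK.
  by apply: (le_lt_trans (ler_nrmD _ _)); rewrite (nrmBC _ x); lra.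
have [v vF] := choice near_V.
have v_cauchy : v \in cauchy_pred.
  rewrite inE => e e0; have e2 : 0 < e / 2 by rewrite divr_gt0.
  have [N hN] := invS_small e2; exists N => m n Nm Nn.
  have [x [/= xm xn]] := filter_ex (filterI (vF m) (vF n)).
  rewrite -nrm_completion_embed linearB /=.
  have -> : completion_embed (v m) - completion_embed (v n) =
    (completion_embed (v m) - x) + (x - completion_embed (v n)).
    by rewrite addrA subrK.
  apply: (le_lt_trans (ler_nrmD _ _)); rewrite (nrmBC x).
  by have := lt_trans xm (hN _ Nm); have := lt_trans xn (hN _ Nn); lra.
pose u := CauchySequence v_cauchy.
apply/cvg_ex; exists (quotient_map limit_seminormP u) => A /nbhs_nrm[e e0 eA].
have e2 : 0 < e / 2 by rewrite divr_gt0.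
have [N1 h1] := invS_small e2; have [N2 h2] := completion_embed_limit u e2.
pose n := maxn N1 N2; apply: filterS (vF n) => x /= vx; apply: eA.
have -> : quotient_map limit_seminormP u - x =
  (quotient_map limit_seminormP u - completion_embed (v n)) + (completion_embed (v n) - x).
  by rewrite addrA subrK.
apply: (le_lt_trans (ler_nrmD _ _)).
have := lt_trans vx (h1 n (leq_maxl _ _)); have := h2 n (leq_maxr _ _).
by rewrite /=; lra.
Qed.

HB.instance Definition _ := Uniform_isComplete.Build seminorm_completion
  seminorm_completion_complete.

End CauchySequences.

Section BanachTargets.
Context {R : realType} {s : scalar_kind}.
Local Notation K := (scalar_field R s).

Lemma complete_sequence (Y : completeNormedModType K) (u : nat -> Y) :
  (forall e : R, 0 < e -> exists N : nat, forall m n : nat,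
     (N <= m)%N -> (N <= n)%N -> nrm (u m - u n) < e) ->
  exists l : Y, forall e : R, 0 < e -> exists N : nat, forall n : nat,
     (N <= n)%N -> nrm (u n - l) < e.
Proof.
move=> u_cau; have : cvg (u @ \oo).
  apply: cauchy_cvg; apply/cauchy_exP => e e0.
  have [N uN] := u_cau _ (gt0_real_part e0); exists (u N); exists N => // n Nn /=.
  by rewrite -(ge0_real_partK (ltW e0)) ball_nrm; exact: uN.
move=> /cvg_ex[l ul]; exists l => e e0.
have /ul[N _ hN] : nbhs l [set y | nrm (l - y) < e] by apply/nbhs_nrm; exists e.
by exists N => n Nn; rewrite nrmBC; exact: hN.
Qed.

(** The value at z is the only y compatible with |y - T x| <= k |z - J x| for
    all x: it is the limit of T x_n whenever J x_n tends to z, and this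
    uniqueness makes the extension linear. *)
Lemma dense_factorization (X : lmodType K) (C : normedModType K)
    (Y : completeNormedModType K) (J : {linear X -> C}) (T : {linear X -> Y}) (k : R) :
  0 < k -> (forall z (e : R), 0 < e -> exists x, nrm (z - J x) < e) ->
  (forall x, nrm (T x) <= k * nrm (J x)) ->
  exists That : {linear C -> Y}, continuous That /\ forall x, T x = That (J x).
Proof.
move=> k0 J_dense T_le.
have T_dist x x' : nrm (T x - T x') <= k * nrm (J x - J x').
  by rewrite -!linearB.
have /choice[F F_le] z : exists y, forall x, nrm (y - T x) <= k * nrm (z - J x).
  have /choice[v zv] n : exists x, nrm (z - J x) < n.+1%:R^-1 by exact: J_dense.
  have [|y Ty] := @complete_sequence Y (fun n => T (v n)).
    move=> e e0; have e2 : 0 < e / (2 * k) by rewrite divr_gt0// mulr_gt0.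
    have [N hN] := invS_small e2; exists N => m n Nm Nn.
    apply: (le_lt_trans (T_dist _ _)).
    have -> : J (v m) - J (v n) = (J (v m) - z) + (z - J (v n)) by rewrite addrA subrK.
    have -> : e = k * (e / (2 * k) + e / (2 * k)) by field; lra.
    rewrite ltr_pM2l//; apply: (le_lt_trans (ler_nrmD _ _)); rewrite (nrmBC _ z).
    by have := lt_trans (zv m) (hN _ Nm); have := lt_trans (zv n) (hN _ Nn); lra.
  exists y => x; apply/ler_addgt0Pl => e e0.
  have d0 : 0 < e / (1 + k) by rewrite divr_gt0//; lra.
  have [N1 h1] := Ty _ d0; have [N2 h2] := invS_small d0.
  pose n := maxn N1 N2.
  have -> : y - T x = (y - T (v n)) + (T (v n) - T x) by rewrite addrA subrK.
  have ed : e = e / (1 + k) + k * (e / (1 + k)) by field; lra.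
  apply: (le_trans (ler_nrmD _ _)).
  have Jd : nrm (J (v n) - J x) <= nrm (z - J (v n)) + nrm (z - J x).
    have -> : J (v n) - J x = (J (v n) - z) + (z - J x) by rewrite addrA subrK.
    by apply: (le_trans (ler_nrmD _ _)); rewrite (nrmBC _ z).
  have := T_dist (v n) x; have := h1 n (leq_maxl _ _); rewrite nrmBC.
  have zvn := lt_trans (zv n) (h2 n (leq_maxr _ _)).
  have : k * nrm (J (v n) - J x) <= k * (e / (1 + k) + nrm (z - J x)).
    by rewrite ler_pM2l//; lra.
  rewrite mulrDr; lra.
have F_uniq z y c : 0 < c -> (forall e : R, 0 < e -> exists2 x, nrm (z - J x) < e &
    nrm (y - T x) <= c * e) -> F z = y.
  move=> c0 h; apply/eqP; rewrite -subr_eq0; apply/eqP/nrm_eq0/eqP.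
  rewrite eq_le nrm_ge0 andbT; apply/ler_addgt0Pl => e e0; rewrite addr0.
  have d0 : 0 < e / (k + c) by rewrite divr_gt0// addr_gt0.
  have [x zx yx] := h _ d0.
  have -> : F z - y = (F z - T x) + (T x - y) by rewrite addrA subrK.
  apply: (le_trans (ler_nrmD _ _)); rewrite (nrmBC (T x)).
  have -> : e = k * (e / (k + c)) + c * (e / (k + c)) by field; lra.
  apply: lerD => //; apply: (le_trans (F_le _ _)).
  by rewrite ler_pM2l// ltW.
have F_lin : linear F.
  move=> a z w; apply: (F_uniq _ _ k) => // e e0.
  have a0 := nrm_ge0 a.
  have d0 : 0 < e / (nrm a + 1) by rewrite divr_gt0//; lra.
  have [x zx] := J_dense z _ d0; have [x' wx'] := J_dense w _ d0.
  have ed : e = nrm a * (e / (nrm a + 1)) + e / (nrm a + 1) by field; lra.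
  exists (a *: x + x').
    rewrite linearP opprD addrACA -scalerBr; apply: (le_lt_trans (ler_nrmD _ _)).
    by rewrite nrmZ [ltRHS]ed; apply: ler_ltD => //; rewrite ler_wpM2l// ltW.
  rewrite linearP opprD addrACA -scalerBr; apply: (le_trans (ler_nrmD _ _)).
  rewrite nrmZ [in leRHS]ed mulrDr mulrCA; apply: lerD.
    by rewrite ler_wpM2l//; apply: (le_trans (F_le _ _)); rewrite ler_pM2l// ltW.
  by apply: (le_trans (F_le _ _)); rewrite ler_pM2l// ltW.
have FJ x : F (J x) = T x.
  apply: (F_uniq _ _ 1) => // e e0; exists x; rewrite subrr nrm0//.
  by rewrite mul1r ltW.
pose FL := GRing.isLinear.Build K C Y *:%R F F_lin.
pose That : {linear C -> Y} := HB.pack F FL.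
exists That; split=> //.
have F_bound z : nrm (F z) <= k * nrm z.
  by have := F_le z 0; rewrite (linear0 T) (linear0 J) !subr0.
move=> z U /nbhs_nrm[e e0 eU]; apply/nbhs_nrm; exists (e / k); first by rewrite divr_gt0.
move=> w zw; apply: eU; rewrite -linearB; apply: (le_lt_trans (F_bound _)).
by rewrite mulrC -ltr_pdivlMr.
Qed.

(** Continuity at 0 and scaling. *)
Lemma continuous_linear_bounded (V W : normedModType K) (f : {linear V -> W}) :
  continuous f -> exists2 c : R, 0 < c & forall v, nrm (f v) <= c * nrm v.
Proof.
move=> f_cont; have : nbhs (f 0) [set w | nrm (0 - w) < 1].
  by rewrite linear0; apply/nbhs_nrm; exists 1.
move=> /f_cont/nbhs_nrm[e e0 fe].
have e2 : 0 < e / 2 by rewrite divr_gt0.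
exists (e / 2)^-1 => [|v]; first by rewrite invr_gt0.
rewrite mulrC ler_pdivlMr//.
have [v0|v0] := eqVneq (nrm v) 0.
  by rewrite (nrm_eq0 v0) linear0 !nrm0 mul0r.
have nv0 : 0 < nrm v by rewrite lt_neqAle eq_sym v0 nrm_ge0.
have t0 : 0 < e / 2 / nrm v by rewrite divr_gt0.
have := fe (of_real (e / 2 / nrm v) *: v).
rewrite /= !sub0r !nrmN linearZ !nrmZ nrm_of_real gtr0_norm// divfK//.
have : e / 2 < e by lra.
move=> h /(_ h) /ltW; rewrite mulrAC ler_pdivrMr// mul1r mulrC.
by [].
Qed.

Lemma nrm_seminorm (V : normedModType K) : seminorm (@nrm R s V).
Proof. by split=> [u v|a v]; [exact: ler_nrmD|exact: nrmZ]. Qed.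

End BanachTargets.
(** * Measurability of scalar functions *)

Section ScalarMeasurability.
Context {R : realType} {s : scalar_kind} d (S : measurableType d).
Local Notation K := (scalar_field R s).
Local Notation measurable_scalar f :=
  (measurable_fun [set: S] (f : S -> borel_scalar (R := R) (s := s))).
Implicit Types f g : S -> K^o.

Lemma scalar_measurableP f :
  measurable_scalar f <-> forall U : set K^o, open U -> measurable (f @^-1` U).
Proof.
split=> [f_meas U oU|f_meas].
  by have := f_meas measurableT U; rewrite setTI; apply; exact: sub_sigma_algebra.
apply: (@measurability _ _ S (@borel_scalar R s) setT f (@open K) erefl).
move=> _ [U oU <-].
by rewrite setTI; exact: f_meas.
Qed.

Lemma open_nrm_lt (z : K) (e : R) : open [set w : K^o | nrm (w - z) < e].
Proof.
rewrite openE => w /= wz; apply/nbhs_nrm; exists (e - nrm (w - z)); first lra.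
move=> w' ww' /=; have -> : w' - z = (w' - w) + (w - z) by rewrite addrA subrK.
by apply: (le_lt_trans (ler_nrmD _ _)); rewrite (nrmBC w'); lra.
Qed.

(** Joint measurability of sums needs the scalars to be second countable: the
    preimage of an open set is a countable union over boxes with rational
    centres and radii 1/(n+1). *)
Lemma measurable_scalar_linear (a : K) f g :
  measurable_scalar f -> measurable_scalar g -> measurable_scalar (a *: f + g).
Proof.
move=> /scalar_measurableP f_meas /scalar_measurableP g_meas.
apply/scalar_measurableP => U oU; have [q q_dense] := @scalar_dense R s.
pose inside (i : (rat * rat) * (rat * rat) * nat) := forall x y : K,
  nrm (x - q i.1.1) < i.2.+1%:R^-1 -> nrm (y - q i.1.2) < i.2.+1%:R^-1 -> U (a * x + y).
pose box (i : (rat * rat) * (rat * rat) * nat) := [set t | [/\ inside i,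
  nrm (f t - q i.1.1) < i.2.+1%:R^-1 & nrm (g t - q i.1.2) < i.2.+1%:R^-1]].
have -> : (a *: f + g) @^-1` U = \bigcup_i box i.
  apply/seteqP; split=> t /=; last by move=> [i _ [h fi gi]]; exact: h.
  move=> Ut; have : nbhs (a * f t + g t : K^o) U by exact: open_nbhs_nbhs (conj oU Ut).
  move=> /nbhs_nrm[e e0 eU]; pose r := e / (2 * (nrm a + 1)).
  have a0 := nrm_ge0 a.
  have r0 : 0 < r by rewrite divr_gt0// mulr_gt0//; lra.
  have [n /(_ _ (leqnn _)) nr] := invS_small r0.
  have n0 : 0 < n.+1%:R^-1 :> R by [].
  have [i fi] := q_dense (f t) _ n0; have [j gj] := q_dense (g t) _ n0.
  exists (i, j, n) => //; split=> //= x y xi yj; apply: eU.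
  have -> : a * f t + g t - (a * x + y) =
      a * ((f t - q i) + (q i - x)) + ((g t - q j) + (q j - y)) by ring.
  have h1 : nrm ((f t - q i) + (q i - x)) < 2 * r.
    apply: (le_lt_trans (ler_nrmD _ _)); rewrite (nrmBC _ x).
    by have := lt_trans fi nr; have := lt_trans xi nr; lra.
  have h2 : nrm ((g t - q j) + (q j - y)) < 2 * r.
    apply: (le_lt_trans (ler_nrmD _ _)); rewrite (nrmBC _ y).
    by have := lt_trans gj nr; have := lt_trans yj nr; lra.
  apply: (le_lt_trans (ler_nrmD _ _)); rewrite nrmM.
  have -> : e = nrm a * (2 * r) + 2 * r by rewrite /r; field; lra.
  by apply: ler_ltD => //; rewrite ler_wpM2l// ltW.
apply: countable_bigcupT_measurable => // i.
have [h|h] := pselect (inside i); last first.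
  by rewrite (_ : box i = set0)//; apply/seteqP; split=> t // -[].
rewrite (_ : box i = (f @^-1` [set w | nrm (w - q i.1.1) < i.2.+1%:R^-1]) `&`
  (g @^-1` [set w | nrm (w - q i.1.2) < i.2.+1%:R^-1])).
  by apply: measurableI; [apply: f_meas|apply: g_meas]; exact: open_nrm_lt.
by apply/seteqP; split=> t /= => [[]|[]].
Qed.

Lemma measurable_nrm f : measurable_scalar f ->
  measurable_fun [set: S] (fun t => nrm (f t) : R).
Proof.
move=> /scalar_measurableP f_meas.
apply: (measurability _ (RGenOInfty.measurableE R)).
move=> _ [_ [a ->] <-]; rewrite setTI.
have nrm_open : open (@nrm R s K^o @^-1` [set x | a < x]).
  apply: (@open_comp K^o R (@nrm R s K^o) [set x | a < x]); last exact: open_gt.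
  by move=> z _; exact: nrm_continuous.
rewrite preimage_itvoy.
exact: (f_meas _ nrm_open).
Qed.

(** Pointwise limits: membership of the limit in an open set U is eventual
    membership of the terms in one of the closed sets of points at distance at
    least 1/(k+1) from the complement of U. *)
Lemma measurable_scalar_limit (u : nat -> S -> K^o) f :
  (forall n, measurable_scalar (u n)) ->
  (forall t (e : R), 0 < e -> exists N : nat, forall n, (N <= n)%N -> nrm (u n t - f t) < e) ->
  measurable_scalar f.
Proof.
move=> u_meas u_lim; apply/scalar_measurableP => U oU.
pose far k : set K^o := ~` \bigcup_(z in ~` U) [set w | nrm (w - z) < k.+1%:R^-1].
have far_meas k n : measurable (u n @^-1` far k).
  rewrite /far preimage_setC; apply: measurableC.
  have near_open : open (\bigcup_(z in ~` U) [set w : K^o | nrm (w - z) < k.+1%:R^-1]).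
    by apply: bigcup_open => z _; exact: open_nrm_lt.
  by move/scalar_measurableP : (u_meas n) => un_meas; exact: (un_meas _ near_open).
rewrite (_ : f @^-1` U = \bigcup_k \bigcup_N \bigcap_(n in [set n | (N <= n)%N]) (u n @^-1` far k)).
  do 2!(apply: bigcupT_measurable => ?).
  exact: bigcap_measurableType.
apply/seteqP; split=> t /=.
  move=> Uft; have : nbhs (f t) U by exact: open_nbhs_nbhs (conj oU Uft).
  move=> /nbhs_nrm[e e0 eU]; have e2 : 0 < e / 2 by rewrite divr_gt0.
  have [k /(_ _ (leqnn _)) ke] := invS_small e2; have [N uN] := u_lim t _ e2.
  exists k => //; exists N => // n /= Nn [z nUz] /= uz; apply: nUz; apply: eU.
  have -> : f t - z = (f t - u n t) + (u n t - z) by rewrite addrA subrK.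
  apply: (le_lt_trans (ler_nrmD _ _)); rewrite (nrmBC (f t)).
  by have := uN n Nn; have := lt_trans uz ke; lra.
move=> [k _ [N _ uN]]; apply: contrapT => nUft.
have [M uM] := u_lim t k.+1%:R^-1 ltac:(by []).
apply: (uN (maxn N M)); first by rewrite /= leq_maxl.
by exists (f t) => //=; apply: uM; exact: leq_maxr.
Qed.

(** Lets a sequence be reset to 0 on a null set where it may diverge. *)
Lemma measurable_scalar_off (A : set S) f : measurable A -> measurable_scalar f ->
  measurable_scalar (fun t => if t \in A then 0 else f t).
Proof.
move=> mA /scalar_measurableP f_meas; apply/scalar_measurableP => U oU.
rewrite (_ : _ @^-1` U = (f @^-1` U `\` A) `|` (A `&` [set _ | U 0])).
  apply: measurableU; first by apply: measurableD => //; exact: f_meas.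
  apply: measurableI => //; have [U0|U0] := pselect (U 0).
    by rewrite (_ : [set _ | _] = setT)//; apply/seteqP; split.
  by rewrite (_ : [set _ | _] = set0)//; apply/seteqP; split.
apply/seteqP; split=> t /=; case: ifPn; rewrite ?notin_setE ?inE => At.
- by right.
- by left.
- by move=> [[]//|[]].
- by move=> [[]|[]].
Qed.

End ScalarMeasurability.

(** * Essentially bounded functions as a Banach function space *)

Section EssentiallyBounded.
Context {R : realType} {s : scalar_kind} d (S : measurableType d).
Local Notation K := (scalar_field R s).
Variable mu : {measure set S -> \bar R}.
Hypothesis mu_finite : (mu setT < +oo)%E.
Implicit Types f g : S -> K^o.

Definition ess_bound f (c : R) := {ae mu, forall t, nrm (f t) <= c}.

Definition ess_bounded : set (S -> K^o) := [set f |
  measurable_fun [set: S] (f : S -> borel_scalar) /\ exists c, ess_bound f c].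

Definition ess_norm f : R := inf [set c | 0 <= c /\ ess_bound f c].

Lemma ess_bound_le f (c c' : R) : c <= c' -> ess_bound f c -> ess_bound f c'.
Proof. by move=> cc'; apply: filterS => t /le_trans; exact. Qed.

Lemma ess_norm_has_inf f : ess_bounded f -> has_inf [set c | 0 <= c /\ ess_bound f c].
Proof.
move=> [_ [c fc]]; split; last by exists 0 => c' [].
exists `|c|; split=> //; exact: ess_bound_le (ler_norm c) fc.
Qed.

Lemma ess_norm_le f (c : R) : 0 <= c -> ess_bound f c -> ess_norm f <= c.
Proof. by move=> c0 fc; apply: ge_inf; [exists 0 => c' []|split]. Qed.

Lemma ess_norm_ge0 f : 0 <= ess_norm f.
Proof.
rewrite /ess_norm; have [->|/set0P ne] := eqVneq [set c | 0 <= c /\ ess_bound f c] set0.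
  by rewrite inf0.
by apply: lb_le_inf => // c [].
Qed.

Lemma ess_norm_bound f : ess_bounded f -> ess_bound f (ess_norm f).
Proof.
move=> fZ; have approx n : ess_bound f (ess_norm f + n.+1%:R^-1).
  have n0 : 0 < n.+1%:R^-1 :> R by [].
  have [c [c0 fc] cn] := inf_adherent n0 (ess_norm_has_inf fZ).
  exact: ess_bound_le (ltW cn) fc.
apply: filterS (ae_foralln approx) => t ft.
apply/ler_addgt0Pr => e e0; have [n /(_ _ (leqnn _)) ne] := invS_small e0.
by apply: le_trans (ft n) _; rewrite lerD2l ltW.
Qed.

Lemma ess_bounded_linear (a : K) f g : ess_bounded f -> ess_bounded g ->
  ess_bounded (a *: f + g).
Proof.
move=> [f_meas [c fc]] [g_meas [c' gc']]; split; first exact: measurable_scalar_linear.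
exists (nrm a * c + c'); apply: filterS2 fc gc' => t ft gt.
apply: (le_trans (ler_nrmD _ _)); apply: lerD => //.
by rewrite nrmM ler_wpM2l ?nrm_ge0.
Qed.

Lemma ess_bounded0 : ess_bounded (0 : S -> K^o).
Proof.
split; first exact: measurable_cst.
by exists 0; apply: filterS filterT => t _; rewrite nrm0.
Qed.

Lemma ess_boundedZ (a : K) f : ess_bounded f -> ess_bounded (a *: f).
Proof.
move=> fZ; rewrite -[_ *: _]addr0; apply: ess_bounded_linear => //.
exact: ess_bounded0.
Qed.

Lemma ess_normD f g : ess_bounded f -> ess_bounded g ->
  ess_norm (f + g) <= ess_norm f + ess_norm g.
Proof.
move=> fZ gZ; apply: ess_norm_le; first by rewrite addr_ge0 ?ess_norm_ge0.
apply: filterS2 (ess_norm_bound fZ) (ess_norm_bound gZ) => t ft gt.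
by apply: (le_trans (ler_nrmD _ _)); exact: lerD.
Qed.

Lemma ess_normZ_le (a : K) f : ess_bounded f -> ess_norm (a *: f) <= nrm a * ess_norm f.
Proof.
move=> fZ; apply: ess_norm_le; first by rewrite mulr_ge0 ?nrm_ge0 ?ess_norm_ge0.
apply: filterS (ess_norm_bound fZ) => t ft.
by rewrite nrmM ler_wpM2l ?nrm_ge0.
Qed.

Lemma ess_norm_class_norm : ae_class_norm mu ess_bounded ess_norm.
Proof.
split; first exact: ess_normD.
- move=> a f fZ; apply/eqP; rewrite eq_le ess_normZ_le//=.
  have [->|a0] := eqVneq a 0; first by rewrite nrm0 mul0r ess_norm_ge0.
  have na0 : 0 < nrm a.
    rewrite lt_neqAle nrm_ge0 andbT eq_sym.
    by apply: contra_neq a0; exact: nrm_eq0.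
  rewrite -ler_pdivlMl// -nrmV.
  by apply: le_trans (ess_normZ_le _ (ess_boundedZ a fZ)); rewrite scalerA mulVf// scale1r.
- move=> f fZ; split=> [f0|f0].
    apply: filterS (ess_norm_bound fZ) => t; rewrite f0 => ft.
    by apply: nrm_eq0; apply/eqP; rewrite eq_le ft nrm_ge0.
  apply/eqP; rewrite eq_le ess_norm_ge0 andbT; apply: ess_norm_le => //.
  by apply: filterS f0 => t ->; rewrite nrm0.
Qed.

Lemma ess_bounded_integrable f : ess_bounded f ->
  mu.-integrable [set: S] (fun t => (nrm (f t))%:E).
Proof.
move=> [f_meas [c fc]]; apply/integrableP; split.
  by apply/measurable_EFinP; exact: measurable_nrm.
apply: (@le_lt_trans _ _ (\int[mu]_(t in [set: S]) (`|c|%:E))%E).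
  apply: ae_ge0_le_integral => //.
  - by apply/measurable_EFinP; apply: measurableT_comp => //; exact: measurable_nrm.
  - apply: filterS fc => t ft _; rewrite lee_fin ger0_norm ?nrm_ge0//.
    exact: le_trans ft (ler_norm _).
rewrite integral_cst// lte_mul_pinfty//.
Qed.

Lemma ess_bounded_simple f : measurable_fun [set: S] (f : S -> borel_scalar) ->
  finite_set (range f) -> ess_bounded f.
Proof.
move=> f_meas f_fin; split=> //.
have [c hc] : exists c : R, forall z, range f z -> nrm z <= c.
  have /finite_seqP[r rE] := f_fin.
  exists (\sum_(z <- r) nrm z) => z; rewrite rE /= => zr.
  rewrite (perm_big _ (perm_to_rem zr)) /= big_cons lerDl.
  by apply: sumr_ge0 => w _; exact: nrm_ge0.
by exists c; apply: filterS filterT => t _; apply: hc; exists t.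
Qed.

Lemma ess_norm_ideal f g : ess_bounded g ->
  measurable_fun [set: S] (f : S -> borel_scalar) ->
  {ae mu, forall t, nrm (f t) <= nrm (g t)} ->
  ess_bounded f /\ ess_norm f <= ess_norm g.
Proof.
move=> gZ f_meas fg.
have fb : ess_bound f (ess_norm g).
  by apply: filterS2 fg (ess_norm_bound gZ) => t; exact: le_trans.
split; first by split=> //; exists (ess_norm g).
by apply: ess_norm_le fb; exact: ess_norm_ge0.
Qed.

(** Off one measurable null set the sequence is uniformly Cauchy, so its
    pointwise limit, put equal to 0 on that set, is the limit in norm. *)
Lemma ess_norm_complete (u : nat -> S -> K^o) :
  (forall n, ess_bounded (u n)) ->
  (forall e : R, 0 < e -> exists n0 : nat, forall m n : nat,
     (n0 <= m)%N -> (n0 <= n)%N -> ess_norm (u m - u n) < e) ->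
  exists2 f, ess_bounded f & ess_norm (u n - f) @[n --> \oo] --> (0 : R).
Proof.
move=> uZ u_cau.
have subZ m n : ess_bounded (u m - u n).
  by rewrite addrC -scaleN1r; exact: ess_bounded_linear.
have [A [mA A0 A_bad]] : {ae mu, forall t, forall m n : nat,
    nrm (u m t - u n t) <= ess_norm (u m - u n)}.
  by apply: ae_foralln => m; apply: ae_foralln => n; exact: (ess_norm_bound (subZ m n)).
have good t : ~ A t -> forall m n, nrm (u m t - u n t) <= ess_norm (u m - u n).
  by move=> nAt; apply: contrapT => bad; apply/nAt/A_bad.
pose v n t : K := if t \in A then 0 else u n t.
have /choice[f f_lim] t : exists l : K, forall e : R, 0 < e -> exists N : nat,
    forall n, (N <= n)%N -> nrm (v n t - l) < e.
  apply: scalar_complete => e e0; have [At|nAt] := pselect (A t).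
    by exists 0%N => m n _ _; rewrite /v mem_set// subrr nrm0.
  have tA : (t \in A) = false by apply/negP => /set_mem; exact: nAt.
  have [N uN] := u_cau _ e0; exists N => m n Nm Nn; rewrite /v tA.
  by apply: (le_lt_trans _ (uN _ _ Nm Nn)); exact: good.
have f_meas : measurable_fun [set: S] (f : S -> borel_scalar).
  apply: (@measurable_scalar_limit R s d S v) => // n.
  by apply: measurable_scalar_off => //; case: (uZ n).
have A_null : {ae mu, forall t, ~ A t}.
  by exists A; split=> // t /= /contrapT.
have uf_bound (e : R) : 0 < e -> exists N, forall n, (N <= n)%N -> ess_bound (u n - f) e.
  move=> e0; have e2 : 0 < e / 2 by rewrite divr_gt0.
  have [N uN] := u_cau _ e2; exists N => n Nn.
  apply: filterS A_null => t nAt.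
  have tA : (t \in A) = false by apply/negP => /set_mem; exact: nAt.
  have [M fM] := f_lim t _ e2; pose m := maxn N M.
  change (nrm (u n t - f t) <= e).
  have -> : u n t - f t = (u n t - u m t) + (u m t - f t) by rewrite addrA subrK.
  have := fM m (leq_maxr _ _); rewrite /v tA.
  have := good t nAt n m; have := uN n m Nn (leq_maxl _ _).
  by have := ler_nrmD (u n t - u m t) (u m t - f t); lra.
exists f.
  split=> //; have [N hN] := uf_bound 1 ltr01; have [_ [c uc]] := uZ N.
  exists (c + 1); apply: filterS2 uc (hN N (leqnn _)) => t ut uft.
  have := ler_nrmB (f t) (u N t); rewrite nrmBC.
  by have : nrm (u N t - f t) <= 1 := uft; lra.
apply/cvgrPdist_lt => e e0; have e2 : 0 < e / 2 by rewrite divr_gt0.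
have [N hN] := uf_bound _ e2; exists N => // n Nn /=.
rewrite sub0r normrN ger0_norm ?ess_norm_ge0//.
by have := ess_norm_le (ltW e2) (hN n Nn); lra.
Qed.

Definition essentially_bounded_space : banach_function_space (s := s) mu :=
  @BanachFunctionSpace R s d S mu ess_bounded ess_norm
    (fun f fZ => fZ.1) ess_bounded_integrable ess_bounded_simple
    ess_bounded_linear ess_norm_class_norm ess_norm_complete ess_norm_ideal.

End EssentiallyBounded.
(** * The domination space *)

Section Implications.
Context {R : realType} {s : scalar_kind}.
Local Notation K := (scalar_field R s).
Variables (X Y : completeNormedModType K) (p : R) (T : {linear X -> Y}).
Variable Phi : hat X -> cont_ball X.
Hypothesis p1 : 1 <= p.
Hypothesis Phi_homogeneous : pos_homogeneous Phi.

Let p0 : 0 < p. Proof. exact: lt_le_trans p1. Qed.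

Lemma p_mean_ge0 (eta : probability (borel_ball X) R) (x : X) : 0 <= p_mean Phi p eta x.
Proof. exact: powR_ge0. Qed.

(** Homogeneity at the scale 2 forces Phi 0 = 0. Hence the domination inequality
    makes T vanish wherever <x,.> does, so T x is determined by <x,.>. *)
Lemma p_mean_kernel (eta : probability (borel_ball X) R) (x : X) :
  to_hat x = 0 -> p_mean Phi p eta x = 0.
Proof.
move=> x0; have Phi0 : Phi 0 = 0.
  have := Phi_homogeneous 0 (ltr0Sn R 1); rewrite scaler0.
  have -> : of_real 2 = 2 :> K by rewrite -[2]/(1 + 1) of_realD of_real1.
  rewrite scaler_nat mulr2n => /eqP; rewrite -subr_eq0 opprD addNKr oppr_eq0.
  by move=> /eqP.
have Phi0E (b : dual_ball X) : nrm (Phi 0 b) `^ p = 0.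
  by rewrite Phi0 (_ : (0 : cont_ball X) b = 0)// nrm0 powR0// gt_eqF.
rewrite /p_mean x0 (_ : (fun _ => _) = (fun=> 0)); last exact/funext.
by rewrite Rintegral_cst//= mul0r powR0// invr_eq0 gt_eqF.
Qed.

(** Take the decomposition of x into the single term x. *)
Lemma dom_norm_le (eta : probability (borel_ball X) R) (x : X) :
  dom_norm Phi p eta (to_hat x) <= p_mean Phi p eta x.
Proof.
apply: ge_inf.
  by exists 0 => _ [r [y [_ ->]]]; apply: sumr_ge0 => i _; exact: p_mean_ge0.
by exists 0%N, (fun=> x); rewrite !big_ord1.
Qed.

(** By the triangle inequality a bound by the p-mean sums up along every
    decomposition of x, hence passes to the infimum. *)
Lemma nrm_le_dom_norm (k : R) (eta : probability (borel_ball X) R) : 0 < k ->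
  (forall x, nrm (T x) <= k * p_mean Phi p eta x) ->
  forall x, nrm (T x) <= k * dom_norm Phi p eta (to_hat x).
Proof.
move=> k0 T_le x; rewrite -ler_pdivrMl//; apply: lb_le_inf.
  by exists (\sum_(i < 1) p_mean Phi p eta x), 0%N, (fun=> x); rewrite big_ord1.
move=> _ [r [y [xy ->]]]; rewrite ler_pdivrMl// mulr_sumr.
have -> : T x = \sum_(i < r.+1) T (y i).
  rewrite -linear_sum; apply/eqP; rewrite -subr_eq0 -linearB.
  apply/eqP/nrm_eq0/eqP; rewrite eq_le nrm_ge0 andbT.
  apply: (le_trans (T_le _)); rewrite p_mean_kernel ?mulr0//.
  by rewrite -scaleN1r addrC to_hat_linear xy scaleN1r addNr.
by apply: (le_trans (ler_nrm_sum _)); exact: ler_sum.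
Qed.

(** The completion step treats the quotient as seminormed by its own norm, so
    that one construction by quotients serves both steps. *)
Definition concrete_domination_space (q : hat X -> R) (qP : seminorm q) :
  domination_space q.
Proof.
refine (@DominationSpace R s X q (seminorm_quotient qP) (quotient_map qP) _ _ _
  (seminorm_completion (nrm_seminorm (seminorm_quotient qP)))
  (completion_embed (nrm_seminorm (seminorm_quotient qP))) _ _).
- exact: quotient_map_surj.
- move=> h; rewrite -(nrm_quotient_map qP); split=> [->|]; first exact: nrm0.
  exact: nrm_eq0.
- exact: nrm_quotient_map.
- exact: nrm_completion_embed.
- apply/seteqP; split=> // x _ A /nbhs_nrm[e e0 eA].
  have [w xw] := completion_embed_dense x e0.
  by exists (completion_embed (nrm_seminorm _) w); split; [exists w|exact: eA].
Defined.

Lemma domination_factors (k : R) (eta : probability (borel_ball X) R) :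
  seminorm (dom_norm Phi p eta) -> 0 < k ->
  (forall x, nrm (T x) <= k * p_mean Phi p eta x) ->
  exists (D : domination_space (dom_norm Phi p eta)) (That : {linear D -> Y}),
    continuous That /\ forall x : X, T x = That (dom_map D (to_hat x)).
Proof.
move=> qP k0 T_le; have T_dom := nrm_le_dom_norm k0 T_le.
pose D := concrete_domination_space qP.
have J_lin : linear (fun x : X => dom_map D (to_hat x)).
  by move=> a x y; rewrite to_hat_linear /dom_map !linearP.
pose J : {linear X -> D} := HB.pack (fun x : X => dom_map D (to_hat x))
  (GRing.isLinear.Build K X D *:%R _ J_lin).
have JE x : J x = dom_map D (to_hat x) by [].
exists D; apply: (@dense_factorization R s X D Y J T k) => //.
  move=> z e e0.
  have [w zw] := completion_embed_dense z e0.
  have [h hw] := dom_proj_surj (d := D) w.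
  have /set_mem[x _ xh] := hat_valP h.
  exists x; rewrite JE /dom_map (_ : to_hat x = h) ?hw//.
  exact/val_inj.
move=> x; rewrite JE /dom_map dom_embed_norm dom_proj_norm.
exact: T_dom.
Qed.

Lemma factors_p_mean_le (eta : probability (borel_ball X) R)
    (D : domination_space (dom_norm Phi p eta)) (That : {linear D -> Y}) :
  continuous That -> (forall x : X, T x = That (dom_map D (to_hat x))) ->
  exists2 c : R, 0 < c & forall x, nrm (T x) <= c * p_mean Phi p eta x.
Proof.
move=> /continuous_linear_bounded[c c0 That_le] T_fact; exists c => // x.
rewrite T_fact (le_trans (That_le _))// ler_pM2l// /dom_map.
by rewrite dom_embed_norm dom_proj_norm dom_norm_le.
Qed.

(** * Function spaces over a Borel probability on the dual ball *)

Lemma completion_on_borel (mu : {measure set (borel_ball X) -> \bar R}) (A : set (borel_ball X)) :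
  measurable A -> measurable (A : set (caratheodory_type (mu^*)%mu)) /\
    completion mu A = mu A.
Proof.
move=> mA; split; first exact: caratheodory_measurable_mu_ext.
exact: measurable_mu_extE.
Qed.

Lemma continuous_completion_measurable (mu : {measure set (borel_ball X) -> \bar R})
    (f : cont_ball X) :
  measurable_fun [set: caratheodory_type (mu^*)%mu]
    (f : caratheodory_type (mu^*)%mu -> borel_scalar).
Proof.
apply/scalar_measurableP => U oU; have := cont_funP f; rewrite inE => f_cont.
apply: (@completion_on_borel mu (f @^-1` U) _).1; apply: open_borel.
by apply: (@open_comp (dual_ball X) K^o f U) => // b _; exact: f_cont.
Qed.

Lemma p_sum_continuous (n : nat) (x : 'I_n -> X) :
  (p_sum Phi p x : dual_ball X -> K^o) \in continuous_pred (X := X).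
Proof.
rewrite inE => b; apply: (@continuous_comp (dual_ball X) R K^o
  (fun b => (\sum_(i < n) nrm (Phi (to_hat (x i)) b) `^ p) `^ p^-1) of_real).
  apply: continuous_powR_comp; first by rewrite invr_gt0.
    by move=> b'; exact: p_pow_sum_ge0.
  exact: p_pow_sum_continuous.
move=> U /nbhs_nrm[e e0 eU]; apply/nbhs_ballP; exists e => //= y.
rewrite /ball/= => xy; apply: eU; set u := (X in of_real X - _).
have -> : of_real u - of_real y = of_real (u - y) :> K.
  by apply/eqP; rewrite subr_eq -of_realD subrK.
by rewrite nrm_of_real.
Qed.

Definition p_sum_cont (n : nat) (x : 'I_n -> X) : cont_ball X :=
  ContBall (p_sum_continuous x).

(** Any Banach function space whose norm dominates that of L^p(eta) would serve.
    The space of essentially bounded functions does, as eta has mass 1, and its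
    completeness needs only uniform convergence off a null set. *)
Lemma summing_essentially_bounded (eta : probability (borel_ball X) R) (c : R) : 0 < c ->
  (forall x, nrm (T x) <= c * p_mean Phi p eta x) ->
  exists Z : banach_function_space (s := s) (completion eta),
    identification_continuous Z /\
    forall (n : nat) (x : 'I_n -> X),
      (\sum_(i < n) nrm (T (x i)) `^ p) `^ p^-1 <= c * bfs_norm Z (p_sum Phi p x).
Proof.
move=> c0 T_le.
have total : completion eta setT = 1%E.
  by rewrite (completion_on_borel eta measurableT).2; exact: (@probability_setT _ _ _ eta).
have fin : (completion eta setT < +oo)%E by rewrite total ltry.
exists (essentially_bounded_space fin).
have cont_bound (f : cont_ball X) : ess_bound (completion eta) f (sup_norm f).
  by apply: filterS filterT => b _; exact: nrm_le_sup_norm.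
have cont_mem (f : cont_ball X) : ess_bounded (completion eta) f.
  by split; [exact: continuous_completion_measurable|exists (sup_norm f)].
split.
  split; first exact: cont_mem.
  move=> f e e0; exists e => // g gf; apply: le_lt_trans gf.
  apply: ess_norm_le; last exact: cont_bound.
  exact: le_trans (nrm_ge0 _) (nrm_le_sup_norm (g - f) point).
move=> n x; set N := bfs_norm _ _.
have N0 : 0 <= N by exact: ess_norm_ge0.
pose g (b : dual_ball X) := \sum_(i < n) nrm (Phi (to_hat (x i)) b) `^ p.
have g_cont : continuous g by exact: p_pow_sum_continuous.
have g0 b : 0 <= g b by exact: p_pow_sum_ge0.
have Np0 : 0 <= N `^ p by exact: powR_ge0.
pose bad := [set b : borel_ball X | N `^ p < g b].
have bad_meas : measurable bad.
  apply: open_borel; apply: (@open_comp (dual_ball X) R g [set y | N `^ p < y]).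
    by move=> b _; exact: g_cont.
  exact: open_gt.
(* The exceptional set is only measurable for the completion; the superlevel set
   inside it is open, hence null for eta itself. *)
have bad_null : eta bad = 0%E.
  have mem : ess_bounded (completion eta) (p_sum Phi p x) := cont_mem (p_sum_cont x).
  have [A [mA A0 A_bad]] := ess_norm_bound mem.
  have [bad_cara bad_eq] := completion_on_borel eta bad_meas.
  have : (completion eta bad <= completion eta A)%E; last first.
    by rewrite bad_eq A0 => eta_bad; apply/eqP; rewrite eq_le measure_ge0 andbT.
  apply: le_measure; rewrite ?inE//.
  move=> b /= Nb; apply: A_bad => /=; apply/negP; rewrite -ltNge nrm_p_sum.
  by rewrite -(powR_mono_lt p0) ?powR_ge0// powRVK ?p_pow_sum_ge0.
have mean_pow i : ((p_mean Phi p eta (x i) `^ p)%:E =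
    \int[eta]_(b in [set: borel_ball X]) (nrm (Phi (to_hat (x i)) b) `^ p)%:E)%E.
  rewrite /p_mean powRVK//; last by apply: Rintegral_ge0 => b _; exact: powR_ge0.
  have [M hM] := compact_bounded_above (@dual_ball_compact _ _ X) (p_pow_continuous (Phi := Phi) p1 (x := x i)).
  rewrite /Rintegral fineK//; apply: integrable_fin_num => //.
  apply: (bounded_borel_integrable _ (c := M)).
    exact: p_pow_continuous.
  move=> b.
  by rewrite ger0_norm// powR_ge0.
have sum_le : \sum_(i < n) p_mean Phi p eta (x i) `^ p <= N `^ p.
  rewrite -lee_fin -sumEFin; under eq_bigr do rewrite mean_pow.
  have pow_meas i : measurable_fun [set: borel_ball X]
      (fun b : borel_ball X => (nrm (Phi (to_hat (x i)) b) `^ p)%:E).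
    by apply/measurable_EFinP; apply: continuous_borel_measurable; exact: p_pow_continuous.
  rewrite -ge0_integral_sum//; last by move=> i b _; rewrite lee_fin powR_ge0.
  apply: (@le_trans _ _ (\int[eta]_(b in [set: borel_ball X]) (N `^ p)%:E)%E).
    apply: ae_ge0_le_integral => //.
    - by move=> b _; apply: sume_ge0 => i _; rewrite lee_fin powR_ge0.
    - exact: (emeasurable_sum _ pow_meas).
    - exists bad; split=> // b /= nb; apply: contrapT => /negP.
      rewrite -leNgt => gb; apply: nb => _.
      by rewrite sumEFin lee_fin.
  by rewrite integral_cst//= probability_setT mule1.
rewrite -(powR_mono_le p0) ?powR_ge0 ?mulr_ge0 ?(ltW c0)//.
rewrite powRVK//; last by apply: sumr_ge0 => i _; exact: powR_ge0.
rewrite powRM ?(ltW c0)//.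
apply: (@le_trans _ _ (c `^ p * \sum_(i < n) p_mean Phi p eta (x i) `^ p)); last first.
  by rewrite ler_wpM2l// powR_ge0.
rewrite mulr_sumr; apply: ler_sum => i _.
rewrite -powRM ?(ltW c0) ?p_mean_ge0//.
by rewrite powR_mono_le// ?nrm_ge0// mulr_ge0 ?(ltW c0) ?p_mean_ge0.
Qed.

(** The identification is linear, so continuity at 0 gives a bound by scaling. *)
Lemma identification_bounded (mu : {measure set (borel_ball X) -> \bar R})
    (Z : banach_function_space (s := s) (completion mu)) :
  identification_continuous Z ->
  exists2 c : R, 0 < c & forall f : cont_ball X, bfs_norm Z f <= c * sup_norm f.
Proof.
move=> [Z_mem Z_cont]; have [d d0 small] := Z_cont 0 1 ltr01.
have [_ NZ _] := bfs_normP Z.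
exists d^-1 => [|f]; first by rewrite invr_gt0.
apply/ler_addgt0Pr => e e0.
have sf0 : 0 <= sup_norm f by exact: le_trans (nrm_ge0 _) (nrm_le_sup_norm f point).
(* The extra d * e keeps the scaling factor finite when sup_norm f = 0. *)
pose m := sup_norm f + d * e.
have m0 : 0 < m by rewrite ltr_wpDl// mulr_gt0.
have t0 : 0 < d / m by rewrite divr_gt0.
have := small (of_real (d / m) *: f); rewrite subr0.
have -> : bfs_norm Z (of_real (d / m) *: f : cont_ball X) = d / m * bfs_norm Z f.
  have := NZ (of_real (d / m)) f (Z_mem f).
  by rewrite nrm_of_real gtr0_norm// => <-.
have le_d : sup_norm (of_real (d / m) *: f : cont_ball X) < d.
  apply: (@le_lt_trans _ _ (d / m * sup_norm f)).
    apply: sup_norm_le => b; rewrite (_ : (_ *: _ : cont_ball X) b = of_real (d / m) * f b)//.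
    by rewrite nrmM nrm_of_real gtr0_norm// ler_pM2l// nrm_le_sup_norm.
  by rewrite mulrAC ltr_pdivrMr// ltr_pM2l// /m ltrDl mulr_gt0.
move=> /(_ le_d) /ltW; rewrite mulrAC ler_pdivrMr// mul1r.
rewrite -ler_pdivlMl// /m mulrDr mulKf ?gt_eqF//.
Qed.

End Implications.
(** * The equivalence *)

Theorem theorem2p4 (R : realType) (s : scalar_kind)
    (X Y : completeNormedModType (scalar_field R s))
    (p : R) (hp : 1 <= p)
    (T : {linear X -> Y}) (hT : continuous T)
    (Phi : hat X -> cont_ball X)
    (hPhi : pos_homogeneous Phi) (bPhi : bounded_map Phi)
    (hdom : forall eta : probability (borel_ball X) R,
      seminorm (dom_norm Phi p eta) /\
      sup_norm_continuous (dom_norm Phi p eta)) :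
  [<->
    (exists (K : R) (mu : {finite_measure set (borel_ball X) -> \bar R})
        (Z : banach_function_space (completion mu)),
      [/\ 0 < K, identification_continuous Z &
          forall (n : nat) (x : 'I_n -> X),
            (\sum_(i < n) nrm (T (x i)) `^ p) `^ p^-1
              <= K * bfs_norm Z (p_sum Phi p x)]);
    (exists2 K : R, 0 < K & forall (n : nat) (x : 'I_n -> X),
      (\sum_(i < n) nrm (T (x i)) `^ p) `^ p^-1
        <= K * sup_norm (p_sum Phi p x));
    (exists (K : R) (eta : probability (borel_ball X) R),
      0 < K /\ forall x : X, nrm (T x) <= K * p_mean Phi p eta x);
    (exists (eta : probability (borel_ball X) R)
        (D : domination_space (dom_norm Phi p eta))
        (That : {linear D -> Y}),
      continuous That /\ forall x : X, T x = That (dom_map D (to_hat x)))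
  ].
Proof.
tfae.
- move=> [K [mu [Z [K0 Z_cont summing]]]].
  have [c c0 Z_le] := identification_bounded Z_cont.
  exists (K * c) => [|n x]; first exact: mulr_gt0.
  apply: (le_trans (summing n x)); rewrite -mulrA ler_pM2l//.
  exact: (Z_le (p_sum_cont Phi hp x)).
- move=> [K K0 summing]; have [eta T_le] := pietsch_domination hp hPhi K0 summing.
  by exists K, eta.
- move=> [K [eta [K0 T_le]]]; exists eta.
  exact: (domination_factors hp hPhi (hdom eta).1 K0).
- move=> [eta [D [That [That_cont T_fact]]]].
  have [c c0 T_le] := factors_p_mean_le That_cont T_fact.
  have [Z [Z_cont summing]] := summing_essentially_bounded hp c0 T_le.
  by exists c, eta, Z.
Qed.
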